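(* Let $v \geq 3$ be an integer. There exists a $\mathrm{TTS}(v)$ whose $2$-BIG has a Hamilton path if and only if $v \equiv 0$ or $1 \pmod 3$ and $v \neq 3$.
   Context: A twofold triple system of order $v$, denoted $\mathrm{TTS}(v)$, is a pair $(V,\mathcal{B})$ where $V$ is a set of $v$ points and $\mathcal{B}$ is a collection of $3$-element subsets of $V$ (called blocks or triples; repeated blocks are permitted, i.e. $\mathcal{B}$ is a multiset) such that each $2$-element subset of $V$ is contained in exactly two blocks of $\mathcal{B}$, counted with multiplicity. The $2$-block-intersection graph ($2$-BIG) of $(V,\mathcal{B})$ is the graph whose vertices are the blocks in $\mathcal{B}$ (repeated blocks giving distinct vertices), where two vertices $B_1,B_2$ are adjacent if and only if $|B_1\cap B_2|=2$. A Hamilton path is a path through all vertices of the graph. *)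

(* Defs.v *)
From mathcomp Require Import all_boot.

Set Implicit Arguments.
Unset Strict Implicit.
Unset Printing Implicit Defensive.

(* The block multiset is a sequence; the order of the sequence is immaterial. *)
Definition is_TTS (v : nat) (V : finType) (B : seq {set V}) : Prop :=
  [/\ #|V| = v,
      forall b : {set V}, b \in B -> #|b| = 3
    & forall P : {set V}, #|P| = 2 -> count (fun b : {set V} => P \subset b) B = 2].

(* Vertices are positions in B rather than sets, so that repeated blocks give
   distinct vertices; two copies of one block meet in 3 points and are
   therefore not adjacent. *)
Definition BIG2 (V : finType) (B : seq {set V}) : rel 'I_(size B) :=
  fun i j => #|nth set0 B i :&: nth set0 B j| == 2.

Definition has_hamilton_path (T : finType) (e : rel T) : Prop :=
  exists (x : T) (p : seq T),
    [/\ path e x p, uniq (x :: p) & forall y : T, y \in x :: p].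

Lemma BIG2_sym (V : finType) (B : seq {set V}) : symmetric (@BIG2 V B).
Proof. by move=> i j; rewrite /BIG2 setIC. Qed.

Lemma BIG2_irr (v : nat) (V : finType) (B : seq {set V}) :
  is_TTS v B -> irreflexive (@BIG2 V B).
Proof. by case=> _ B3 _ i; rewrite /BIG2 setIid B3 // mem_nth. Qed.

(* Main.v *)
Require Import Defs.
From mathcomp Require Import all_boot all_algebra.
From mathcomp Require Import zify ring.

Set Implicit Arguments.
Unset Strict Implicit.
Unset Printing Implicit Defensive.

Import GRing.Theory.

(* A triple system in which every pair lies in two blocks is a pseudosurface
   triangulated by its blocks, and a Hamilton path of its 2-BIG is a walk through
   all triangles across common edges.  Each system below carries an action of a
   cyclic group Z_n, and the walk is a lift of a closed walk through all block
   orbits: one turn advances by a unit u of Z_n, so n turns visit everything.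

   - v = 6h + 1: on Z_n with n = v, blocks {y, y + e_j, y + e_(j+1)} fan out
     around y, where e zigzags twice through an interval, so that the steps
     of e use up the short differences twice; one further block per y leads to
     the next fan.
   - v = 6h: the same on Z_n with n = v - 1, plus one point oo whose blocks
     {oo, y, y + 3h - 1} form a cycle that is walked first.
   - v = 6h + 3: on Z_n x Z_3 with n = 2h + 1.  For each of the three pairs of
     consecutive levels the differences are listed in a zigzag path of Z_n;
     the first h steps give blocks with two points on the lower level, the
     last h steps give blocks with two points on the upper level, and the ends
     of the three paths are joined by two families of transversal blocks.
   - v = 6h + 4: one family of transversal blocks of the previous system
     partitions the points; coning its blocks from a new point keeps the walk.

   Covering every pair at least twice is enough, since the number of blocks is
   v(v-1)/3.  Conversely that number is an integer only if v is 0 or 1 mod 3,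
   and for v = 3 the two blocks coincide. *)

(** * Gluing paths with prescribed ends *)

Section Chain.
Variables (T : eqType) (r : rel T).

(** Both ends are recorded so that pieces can be concatenated by checking a single edge; the empty
    list is excluded because it has no ends. *)
Definition chain (x y : T) (s : seq T) : bool :=
  if s is a :: s' then [&& a == x, path r x s' & last x s' == y] else false.

Lemma chain1 x : chain x x [:: x].
Proof. by rewrite /chain /= !eqxx. Qed.

Lemma chain_cat x y x' y' s s' :
  chain x y s -> r y x' -> chain x' y' s' -> chain x y' (s ++ s').
Proof.
case: s => // a s /and3P[/eqP-> ps /eqP ls] ryx'.
case: s' => // b s' /and3P[/eqP-> ps' ls'].
by rewrite /chain /= eqxx cat_path ps ls /= ryx' ps' last_cat /= ls'.
Qed.

Lemma chain_iota (f : nat -> T) N :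
  (forall j, j < N -> r (f j) (f j.+1)) ->
  chain (f 0) (f N) [seq f j | j <- iota 0 N.+1].
Proof.
elim: N => [|N IHN] rf; first exact: chain1.
rewrite -(addn1 N.+1) iotaD map_cat; apply: chain_cat (chain1 _); last exact: rf.
by apply: IHN => j ltjN; apply: rf; rewrite ltnW.
Qed.

Lemma chain_flatten (W : nat -> seq T) (x y : nat -> T) N :
  (forall k, chain (x k) (y k) (W k)) -> (forall k, r (y k) (x k.+1)) ->
  chain (x 0) (y N) (flatten [seq W k | k <- iota 0 N.+1]).
Proof.
move=> cW rW; elim: N => [|N IHN]; first by rewrite /= cats0.
rewrite -(addn1 N.+1) iotaD map_cat flatten_cat /= cats0.
exact: chain_cat IHN (rW N) (cW _).
Qed.

Lemma chain_sorted x y s : chain x y s -> sorted r s.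
Proof. by case: s => // a s /and3P[/eqP-> ]. Qed.

End Chain.

Lemma chain_map (T T' : eqType) (r : rel T) (r' : rel T') (f : T -> T') x y s :
  (forall a b, r a b -> r' (f a) (f b)) ->
  chain r x y s -> chain r' (f x) (f y) [seq f a | a <- s].
Proof.
move=> rr'; case: s => // a s /and3P[/eqP-> ps /eqP<-].
rewrite /chain /= eqxx last_map eqxx andbT /=.
by elim: s x ps {a} => //= b s IHs x /andP[/rr'-> /IHs].
Qed.

(** * Double counting of pairs and blocks *)

Section PairCount.
Variables (V : finType) (B : seq {set V}).
Hypothesis B3 : forall b, b \in B -> #|b| = 3.

(** Induction on [B]: each block adds its ['C(3, 2) = 3] pairs to the sum. *)
Lemma sum_pair_count :
  \sum_(P : {set V} | #|P| == 2) count (fun b : {set V} => P \subset b) B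
  = 3 * size B.
Proof.
elim: B B3 => [|b B' IHB] B3'; first by rewrite big1.
rewrite big_split /= {}IHB => [|c cB]; last by rewrite B3' // inE cB orbT.
rewrite -big_mkcondr sum1dep_card mulnS; congr (_ + _).
have -> : 3 = 'C(#|b|, 2) by rewrite B3' ?mem_head.
by rewrite -(cards_draws b 2); apply: eq_card => P; rewrite !inE andbC.
Qed.

Lemma mul2_card_pairs : 2 * #|[pred P : {set V} | #|P| == 2]| = #|V| * #|V|.-1.
Proof.
have -> : #|[pred P : {set V} | #|P| == 2]| = 'C(#|V|, 2).
  by rewrite -card_draws; apply: eq_card => P; rewrite !inE.
by rewrite mulnC -[2]/(2`!) bin_ffact ffactnS ffactn1.
Qed.

End PairCount.

Lemma TTS_size (v : nat) (V : finType) (B : seq {set V}) :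
  is_TTS v B -> 3 * size B = v * v.-1.
Proof.
case=> cV B3 B2; rewrite -(sum_pair_count B3) -cV -mul2_card_pairs.
under eq_bigr => P /eqP P2 do rewrite B2 //.
by rewrite sum_nat_const mulnC.
Qed.

(** The counts sum to [3 * size B], which is twice the number of pairs. As each count is at least 2,
    equality of the sums forces equality termwise. *)
Lemma TTS_of_cover (V : finType) (B : seq {set V}) :
  (forall b, b \in B -> #|b| = 3) -> 3 * size B = #|V| * #|V|.-1 ->
  (forall P : {set V}, #|P| = 2 -> 1 < count (fun b : {set V} => P \subset b) B) ->
  is_TTS #|V| B.
Proof.
move=> B3 szB cov; split=> // P P2; apply/esym/eqP.
pose c (P : {set V}) := count (fun b : {set V} => P \subset b) B.
have le2c (Q : {set V}) : #|Q| == 2 -> 2 <= c Q ?= iff (2 == c Q).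
  by move/eqP/cov => ?; split.
have [_] := leqif_sum le2c.
rewrite (sum_pair_count B3) szB -mul2_card_pairs sum_nat_const mulnC eqxx.
by move/esym/forallP/(_ P)/implyP; apply; apply/eqP.
Qed.

(** * Systems and paths given by labelled blocks *)

Section LabelledBlocks.
Variables (V : finType) (L : eqType) (blk : L -> {set V}).

Definition adjacent : rel L := fun l l' => #|blk l :&: blk l'| == 2.

(** Vertices are positions, so a list with adjacent neighbours is traversed by the positions in
    increasing order. *)
Lemma hamilton_of_sorted (s : seq L) : 0 < size s -> sorted adjacent s ->
  has_hamilton_path (@BIG2 V [seq blk l | l <- s]).
Proof.
set B := map _ _ => s_gt0 /sortedP srt.
have szB : size B = size s by rewrite size_map.
have {srt} : sorted (@BIG2 V B) (enum 'I_(size B)).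
  have B_gt0 : 0 < size B by rewrite szB.
  have x0 : 'I_(size B) by exists 0.
  have l0 : L by case: s s_gt0 {B szB B_gt0 x0 srt}.
  apply/(sortedP x0) => i; rewrite size_enum_ord => lti.
  have ltis : i.+1 < size s by rewrite -szB.
  rewrite /BIG2 (nth_enum_ord x0 (ltnW lti)) (nth_enum_ord x0 lti).
  by rewrite (nth_map l0 _ _ (ltnW ltis)) (nth_map l0 _ _ ltis); apply: srt.
have := mem_enum 'I_(size B); have := enum_uniq 'I_(size B).
have := size_enum_ord (size B).
case: (enum 'I_(size B)) => [|x p] /=; first by move=> e0; exfalso; move: s_gt0; rewrite -szB -e0.
by move=> _ uxp memxp pxp; exists x, p; split=> // y; rewrite memxp.
Qed.

(** Two covering blocks may be equal as sets; distinct labels are what makes them count twice. *)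
Lemma TTS_of_labels (s : seq L) :
  (forall l, l \in s -> #|blk l| = 3) -> 3 * size s = #|V| * #|V|.-1 ->
  (forall p q, p != q -> exists l1 l2,
     [/\ l1 \in s, l2 \in s, l1 != l2,
         (p \in blk l1) && (q \in blk l1) & (p \in blk l2) && (q \in blk l2)]) ->
  is_TTS #|V| [seq blk l | l <- s].
Proof.
move=> s3 szs cov; apply: TTS_of_cover => [b /mapP[l /s3 ? ->]||P P2] //.
  by rewrite size_map.
have /cards2P[p [q [npq ->]]] : #|P| == 2 by rewrite P2.
have [l1 [l2 [l1s l2s n12 /andP[p1 q1] /andP[p2 q2]]]] := cov p q npq.
rewrite count_map -size_filter.
apply: (@uniq_leq_size _ [:: l1; l2]) => [|l]; first by rewrite /= inE n12.
by rewrite !inE mem_filter /= => /orP[]/eqP->; rewrite subUset !sub1set;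
   apply/andP; split=> //; apply/andP.
Qed.

End LabelledBlocks.

Lemma card_set3 (T : finType) (a b c : T) :
  a != b -> a != c -> b != c -> #|[set a; b; c]| = 3.
Proof. by move=> ab ac bc; rewrite setUC cardsU1 !inE cards2 ab ![c == _]eq_sym (negPf ac) (negPf bc). Qed.

(** The point [x] makes [A :&: B] a proper subset of [A], so the common edge is all of it. Every
    adjacency below is proved by naming the edge [a b] and such an [x]. *)
Lemma card_setI3 (T : finType) (A B : {set T}) (a b x : T) :
  #|A| = 3 -> #|B| = 3 -> a != b -> [set a; b] \subset A -> [set a; b] \subset B ->
  x \in A -> x \notin B -> #|A :&: B| == 2.
Proof.
move=> A3 B3 nab sA sB xA xB; rewrite eqn_leq; apply/andP; split.
  rewrite -ltnS -A3; apply: proper_card; rewrite properE subsetIl /=.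
  by apply/subsetPn; exists x => //; rewrite inE (negPf xB) andbF.
have <- : #|[set a; b]| = 2 by rewrite cards2 nab.
by apply: subset_leq_card; rewrite subsetI sA.
Qed.

(** * The cyclic group and walks that turn around it *)

Section Zn.
Local Open Scope ring_scope.
Variables (n : nat) (n_gt1 : (1 < n)%N).

Lemma natr_Zn_inj (a b : nat) :
  (a < n)%N -> (b < n)%N -> a%:R = b%:R :> 'Z_n -> a = b.
Proof.
by move=> an bn /(congr1 val); rewrite /= !val_Zp_nat // !modn_small.
Qed.

Lemma addl_natr_neq (y : 'Z_n) (a b : nat) :
  (a < n)%N -> (b < n)%N -> a <> b -> y + a%:R != y + b%:R.
Proof.
by move=> an bn nab; rewrite (inj_eq (addrI y)); apply/eqP => /natr_Zn_inj; auto.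
Qed.

Lemma add_natr_neq (y : 'Z_n) (a : nat) : (0 < a < n)%N -> y != y + a%:R.
Proof.
move=> /andP[a0 an]; rewrite -{1}[y]addr0; apply: (@addl_natr_neq y 0 a) => //.
  exact: ltnW.
by move=> E; rewrite -E in a0.
Qed.

Lemma Zn_natn : n%:R = 0 :> 'Z_n.
Proof. by apply: val_inj; rewrite /= val_Zp_nat // modnn. Qed.

Lemma Zn_val (y : 'Z_n) : exists2 a, (a < n)%N & y = a%:R.
Proof.
exists (val y); last by rewrite natr_Zp.
by rewrite -[X in (_ < X)%N](Zp_cast n_gt1) ltn_ord.
Qed.

(** A difference [d] beyond [n./2] becomes [n - d] after exchanging [p] and [q]. *)
Lemma Zn_pairP (R : 'Z_n -> 'Z_n -> Prop) :
  (forall p q, R p q -> R q p) ->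
  (forall p (d : nat), (0 < d <= n./2)%N -> R p (p + d%:R)) ->
  forall p q, p != q -> R p q.
Proof.
move=> Rsym Rd p q npq; have [d dn Ed] := Zn_val (q - p).
have d_gt0 : (0 < d)%N.
  by case: d Ed {dn} => // /eqP; rewrite subr_eq0 eq_sym (negPf npq).
have [le_d|lt_d] := leqP d n./2.
  by rewrite -[q](subrK p) Ed addrC; apply: Rd; rewrite d_gt0.
apply: Rsym; have -> : p = q + (n - d)%:R.
  by rewrite natrB 1?ltnW // Zn_natn -Ed; ring.
by apply: Rd; lia.
Qed.

Section Walk.
Variables (T : eqType) (u w : 'Z_n) (W : 'Z_n -> seq T).
Hypothesis uw : u * w = 1.

Definition walk := flatten [seq W (u *+ k) | k <- iota 0 n].

(** As [w] inverts [u], the turn based at [y] is the one with index [w * y]. *)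
Lemma mem_walk y l : l \in W y -> l \in walk.
Proof.
move=> lW; have [k kn Ek] := Zn_val (w * y).
apply/flattenP; exists (W y) => //.
apply/mapP; exists k; first by rewrite mem_iota.
by rewrite -mulr_natr -Ek mulrA uw mul1r.
Qed.

Lemma size_walk m : (forall y, size (W y) = m) -> size walk = (n * m)%N.
Proof.
move=> szW; rewrite size_flatten /shape -map_comp sumnE big_map.
under eq_bigr => k _ do rewrite /= szW.
by rewrite big_const_seq count_predT size_iota iter_addn addn0 mulnC.
Qed.

Lemma mem_walkP l : l \in walk -> exists y, l \in W y.
Proof. by case/flattenP=> s /mapP[k _ ->] lW; exists (u *+ k). Qed.

Lemma chain_walk (r : rel T) (x z : 'Z_n -> T) :
  (forall y, chain r (x y) (z y) (W y)) -> (forall y, r (z y) (x (y + u))) ->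
  chain r (x 0) (z (- u)) walk.
Proof.
move=> cW rW; rewrite /walk.
have -> : iota 0 n = iota 0 n.-1.+1 by rewrite (ltn_predK n_gt1).
(* The last turn has index [n - 1], and [n] turns add up to 0. *)
have -> : - u = u *+ n.-1.
  apply/eqP; rewrite eq_sym -subr_eq0 opprK -mulrSr (ltn_predK n_gt1).
  by rewrite -mulr_natr Zn_natn mulr0.
rewrite -[in x 0](mulr0n u).
apply: (chain_flatten (x := fun k => x (u *+ k)) (y := fun k => z (u *+ k))) => // k.
by rewrite mulrSr.
Qed.

End Walk.
End Zn.

(* The inward zigzag 0, k, 1, k-1, ... of the interval [0, k]. *)
Definition zigzag (k j : nat) : nat := if odd j then k - j./2 else j./2.

Lemma zigzag_le k j : j <= k -> zigzag k j <= k.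
Proof. by rewrite /zigzag; case: ifP; lia. Qed.

Lemma zigzag_inj k i j : i <= k -> j <= k -> zigzag k i = zigzag k j -> i = j.
Proof. by rewrite /zigzag; case: ifP; case: ifP; lia. Qed.

Lemma zigzag_surj k t : t <= k -> exists2 j, j <= k & zigzag k j = t.
Proof.
move=> tk; rewrite /zigzag; have [le2t|gt2t] := leqP t.*2 k.
  by exists t.*2; rewrite ?odd_double ?doubleK.
by exists ((k - t).*2.+1); [lia | rewrite /= odd_double /= uphalf_double; lia].
Qed.

(** Jumps alternate between up and down with lengths [k, k - 1, ..., 1], so a zigzag realises each
    of these differences exactly once. *)
Lemma zigzag_step k j : j < k ->
  zigzag k j.+1 = zigzag k j + (k - j) \/ zigzag k j = zigzag k j.+1 + (k - j).
Proof. by rewrite /zigzag /= uphalf_half; case: (boolP (odd j)) => /=; lia. Qed.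

Lemma zigzag_last k : zigzag k k = uphalf k.
Proof. by rewrite /zigzag uphalf_half; case: (boolP (odd k)) => /=; lia. Qed.

(** * Fans over a cyclic group *)

Section Fan.
Local Open Scope ring_scope.
Variables (n m c u : nat) (e : nat -> nat).
Hypothesis n_gt1 : (1 < n)%N.
Hypothesis e_bound : forall j, (j <= m)%N -> (0 < e j < n)%N.
Hypothesis e_inj : forall i j, (i <= m)%N -> (j <= m)%N -> e i = e j -> i = j.
Hypothesis c_bound : (0 < c < n)%N.
Hypothesis u_bound : (0 < u < n)%N.
Hypothesis c_notin : forall j, (j <= m)%N -> e j <> c.
Hypothesis u_notin : forall j, (j <= m)%N -> e j <> u.
Hypothesis c_neq_u : c <> u.
Hypothesis closing :
  (u%:R + c%:R = 0 :> 'Z_n /\ u%:R + (e 0)%:R = (e m)%:R :> 'Z_n) \/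
  (u%:R + (e 0)%:R = 0 :> 'Z_n /\ u%:R + c%:R = (e m)%:R :> 'Z_n).

(* Index 0 is the block that leads from the fan around [y - u] to the one around [y]. *)
Definition fan_block (l : nat * 'Z_n) : {set 'Z_n} :=
  let: (t, y) := l in
  if t is j.+1 then [set y; y + (e j)%:R; y + (e j.+1)%:R]
  else [set y; y + (e 0)%:R; y + c%:R].

Definition fan (y : 'Z_n) : seq (nat * 'Z_n) := [seq (t, y) | t <- iota 0 m.+1].

Lemma card_fan_block t y : (t <= m)%N -> #|fan_block (t, y)| = 3%N.
Proof.
case: t => [_|j ltjm] /=.
  have e0 := @e_bound 0 isT; have ce := @c_notin 0 isT.
  by apply: card_set3; [exact: add_natr_neq..|apply: addl_natr_neq; lia].
have [ej ej1] := (e_bound (ltnW ltjm), e_bound ltjm).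
apply: card_set3; [exact: add_natr_neq..|apply: addl_natr_neq; try lia].
by move/e_inj; lia.
Qed.

Lemma fan_block_e t y : (t <= m)%N ->
  (y \in fan_block (t, y)) && (y + (e t)%:R \in fan_block (t, y)).
Proof. by case: t => [|j] _; rewrite /= !inE !eqxx ?orbT. Qed.

(** The two cases of [closing] differ in which spoke of the new fan, [c] or [e 0], leads back to the
    old centre [y]; the other one ends at the last point [y + e m] of the old fan. *)
Lemma fan_block_closing y :
  (y \in fan_block (0%N, y + u%:R)) && (y + (e m)%:R \in fan_block (0%N, y + u%:R)).
Proof.
rewrite /= !inE; case: closing => [[E1 E2]|[E1 E2]].
  by rewrite -!addrA E1 E2 addr0 !eqxx !orbT.
by rewrite -!addrA E1 E2 addr0 !eqxx !orbT.
Qed.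

(** The edge opposite to the centre has difference [e j.+1 - e j]; the choice of centre puts its
    lower end at [p]. *)
Lemma fan_block_step p j s : (j < m)%N ->
  e j.+1 = (e j + s)%N \/ e j = (e j.+1 + s)%N ->
  exists y, (p \in fan_block (j.+1, y)) && (p + s%:R \in fan_block (j.+1, y)).
Proof.
move=> jm [E|E]; [exists (p - (e j)%:R) | exists (p - (e j.+1)%:R)].
  by rewrite /= !inE E natrD !subrK addrA subrK !eqxx !orbT.
by rewrite /= !inE E natrD !subrK addrA subrK !eqxx !orbT.
Qed.

Lemma fan_adjacent y t : (t < m)%N -> adjacent fan_block (t, y) (t.+1, y).
Proof.
move=> ltm; apply: (@card_setI3 _ _ _ y (y + (e t)%:R) (if t is j.+1 then y + (e j)%:R else y + c%:R)).
- by rewrite card_fan_block // ltnW.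
- by rewrite card_fan_block.
- by rewrite add_natr_neq // e_bound // ltnW.
- by rewrite subUset !sub1set fan_block_e // ltnW.
- by rewrite subUset !sub1set /= !inE !eqxx ?orbT.
- by case: (t) => [|j]; rewrite /= !inE !eqxx ?orbT.
have [et et1] := (e_bound (ltnW ltm), e_bound ltm).
case: t ltm et et1 => [|j] ltm et et1; rewrite /= !inE ![_ == y]eq_sym.
  rewrite !negb_or add_natr_neq // !addl_natr_neq //; try lia.
    by have := c_notin ltm; lia.
  by have := @c_notin 0 isT; lia.
have ej := e_bound (ltnW (ltnW ltm)).
rewrite !negb_or add_natr_neq // !addl_natr_neq //; try lia; move/e_inj; lia.
Qed.

Lemma fan_adjacent_next y :
  adjacent fan_block (m, y) (0%N, y + u%:R).
Proof.
(* For [m = 0] the last block of the fan is also its block 0, whose third point is [y + c]. *)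
apply: (@card_setI3 _ _ _ y (y + (e m)%:R) (if m is j.+1 then y + (e j)%:R else y + c%:R)).
- by rewrite card_fan_block.
- by rewrite card_fan_block.
- by rewrite add_natr_neq // e_bound.
- by rewrite subUset !sub1set fan_block_e.
- by rewrite subUset !sub1set fan_block_closing.
- by case: (m) => [|j]; rewrite /= !inE !eqxx ?orbT.
have -> : fan_block (0%N, y + u%:R) = [set y + u%:R; y; y + (e m)%:R].
  apply/setP => x; rewrite /= !inE -!addrA; case: closing => [[-> ->]|[-> ->]].
    by rewrite addr0 orbAC.
  by rewrite addr0.
have em := @e_bound m (leqnn m).
have := @c_notin m (leqnn m); have := @u_notin _ (leq_pred m); have := @e_bound _ (leq_pred m).
have := @e_inj m.-1 m (leq_pred m) (leqnn m).
case: (m) em => [|j] /= em inj ej uj cm; rewrite !inE [_ == y]eq_sym !negb_or.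
  by rewrite add_natr_neq // !addl_natr_neq //; lia.
rewrite add_natr_neq // !addl_natr_neq //; try lia; move/inj; lia.
Qed.

Lemma fan_chain y : chain (adjacent fan_block) (0%N, y) (m, y) (fan y).
Proof. by apply: (chain_iota (f := fun t => (t, y))) => t; apply: fan_adjacent. Qed.

Lemma mem_fan t y : (t <= m)%N -> (t, y) \in fan y.
Proof. by move=> tm; apply: (map_f (fun t => (t, y))); rewrite mem_iota. Qed.

Definition fan_covered (p q : 'Z_n) : Prop := exists l1 l2,
  [/\ (l1.1 <= m)%N, (l2.1 <= m)%N, l1 != l2,
      (p \in fan_block l1) && (q \in fan_block l1)
    & (p \in fan_block l2) && (q \in fan_block l2)].

(** The spoke [e j] is shared by blocks [j] and [j + 1] of one fan; the last spoke is shared with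
    block 0 of the next fan. *)
Lemma fan_cover_e j y : (j <= m)%N -> fan_covered y (y + (e j)%:R).
Proof.
rewrite leq_eqVlt => /predU1P[->|ltjm].
  exists (m, y), (0%N, y + u%:R); split=> //; last exact: fan_block_closing.
    rewrite xpair_eqE negb_and; apply/orP; right; exact: add_natr_neq.
  exact: fan_block_e.
exists (j, y), (j.+1, y); split=> //=; first exact: ltnW.
- by rewrite xpair_eqE negb_and neq_ltn ltnSn.
- exact/fan_block_e/ltnW.
by rewrite !inE !eqxx orbT.
Qed.

Lemma fan_cover_steps i j p s : (i < m)%N -> (j < m)%N -> i != j ->
  e i.+1 = (e i + s)%N \/ e i = (e i.+1 + s)%N ->
  e j.+1 = (e j + s)%N \/ e j = (e j.+1 + s)%N ->
  fan_covered p (p + s%:R).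
Proof.
move=> im jm nij /(fan_block_step p im)[y1 H1] /(fan_block_step p jm)[y2 H2].
by exists (i.+1, y1), (j.+1, y2); split; rewrite // xpair_eqE eqSS (negPf nij).
Qed.

Definition fan_walk := walk u%:R fan.

Lemma size_fan_walk : size fan_walk = (n * m.+1)%N.
Proof. by apply: size_walk => y; rewrite size_map size_iota. Qed.

Lemma fan_walkP w : u%:R * w = 1 :> 'Z_n ->
  [/\ forall l, l \in fan_walk -> #|fan_block l| = 3%N,
      forall l, (l.1 <= m)%N -> l \in fan_walk,
      chain (adjacent fan_block) (0%N, 0) (m, - u%:R) fan_walk
    & forall j y, (j <= m)%N -> fan_covered y (y + (e j)%:R)].
Proof.
move=> uw; split; last exact: fan_cover_e.
- move=> l /mem_walkP[y] /mapP[t tm ->]; apply: card_fan_block.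
  by rewrite mem_iota in tm.
- by case=> t y tm; apply: (mem_walk n_gt1 uw (y := y)); apply: mem_fan.
apply: (chain_walk n_gt1 (x := fun y => (0%N, y)) (z := fun y => (m, y))).
  exact: fan_chain.
exact: fan_adjacent_next.
Qed.

End Fan.

(** * From a labelled chain to a traceable system *)

Definition traceable_TTS (v : nat) : Prop :=
  exists (V : finType) (B : seq {set V}),
    is_TTS v B /\ has_hamilton_path (@BIG2 V B).

Lemma traceable_of_labels (V : finType) (L : eqType) (blk : L -> {set V})
    (x y : L) (s : seq L) :
  (forall l, l \in s -> #|blk l| = 3) -> 3 * size s = #|V| * #|V|.-1 ->
  (forall p q, p != q -> exists l1 l2,
     [/\ l1 \in s, l2 \in s, l1 != l2,
         (p \in blk l1) && (q \in blk l1) & (p \in blk l2) && (q \in blk l2)]) ->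
  chain (adjacent blk) x y s -> traceable_TTS #|V|.
Proof.
move=> s3 szs cov cs; exists V, [seq blk l | l <- s].
split; first exact: TTS_of_labels.
by apply: hamilton_of_sorted (chain_sorted cs); case: s cs {s3 szs cov}.
Qed.

Lemma card_Zn n : 1 < n -> #|{: 'Z_n}| = n.
Proof. by move=> n_gt1; rewrite card_ord Zp_cast. Qed.

(** * Orders 1 mod 6: fans around the points of one cycle *)

Section OrderOneModSix.
Variables h n : nat.
Hypothesis h_gt0 : 0 < h.
Hypothesis nE : n = 6 * h + 1.
Let m := (2 * h).-1.
(** A zigzag through [[h + 1, 2h]], then its translate by [h] run backwards. The step lengths are
    [h - 1, ..., 1], then [h] at the junction, then [1, ..., h - 1]. *)
Let e j :=
  if j < h then h + 1 + zigzag h.-1 j else 2 * h + 1 + zigzag h.-1 (m - j).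
(** Modulo [n] this is [- h], so block 0 supplies the second edge of difference [h]. *)
Let c := 5 * h + 1.
Let blk := @fan_block n c e.

Let n_gt1 : 1 < n. Proof. by lia. Qed.

Let e_range j : j <= m ->
  if j < h then h < e j <= 2 * h else 2 * h < e j <= 3 * h.
Proof.
rewrite /e /m => jm; case: (ltnP j h) => jh.
  by have := @zigzag_le h.-1 j; lia.
by have := @zigzag_le h.-1 ((2 * h).-1 - j); lia.
Qed.

Let e_inj i j : i <= m -> j <= m -> e i = e j -> i = j.
Proof.
move=> im jm; have := e_range im; have := e_range jm.
rewrite /e; case: (ltnP j h) => jh; case: (ltnP i h) => ih ? ? E; try lia.
  by apply: (@zigzag_inj h.-1); lia.
suff : m - i = m - j by rewrite /m in im jm *; lia.
by apply: (@zigzag_inj h.-1); rewrite /m in im jm E *; lia.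
Qed.

Let Zn6h : ((6 * h)%:R = -1 :> 'Z_n)%R.
Proof. by have := Zn_natn n_gt1; rewrite [X in X%:R%R]nE natrD => /eqP; rewrite addr_eq0 => /eqP. Qed.

Let e_m : e m = 2 * h + 1. Proof. by rewrite /e subnn; case: ltnP; rewrite /m ?addn0 //; lia. Qed.
Let e_0 : e 0 = h + 1. Proof. by rewrite /e h_gt0 addn0. Qed.

Lemma traceable_TTS_1mod6 : traceable_TTS n.
Proof.
have Zh : (6%:R * h%:R = -1 :> 'Z_n)%R by rewrite -natrM Zn6h.
have e_bound j : j <= m -> 0 < e j < n.
  by move=> /e_range; case: ifP; lia.
have c_bound : 0 < c < n by rewrite /c; lia.
have u_bound : 0 < h < n by lia.
have c_notin j : j <= m -> e j <> c.
  by move=> /e_range; rewrite /c; case: ifP; lia.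
have u_notin j : j <= m -> e j <> h.
  by move=> /e_range; case: ifP; lia.
have c_neq_u : c <> h by rewrite /c; lia.
have closing : (h%:R + c%:R = 0 :> 'Z_n /\ h%:R + (e 0)%:R = (e m)%:R :> 'Z_n)%R \/
  (h%:R + (e 0)%:R = 0 :> 'Z_n /\ h%:R + c%:R = (e m)%:R :> 'Z_n)%R.
  left; rewrite e_m e_0 -!natrD; split; last by congr (_%:R)%R; lia.
  by rewrite -(Zn_natn n_gt1); congr (_%:R)%R; rewrite /c; lia.
(* The advance per turn is [h], a unit because [6 * h = -1]. *)
have uw : (h%:R * - 6%:R = 1 :> 'Z_n)%R by rewrite mulrN mulrC Zh opprK.
have [s3 s_mem s_chain cov_e] :=
  fan_walkP n_gt1 e_bound e_inj c_bound u_bound c_notin u_notin c_neq_u closing uw.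
rewrite -[X in traceable_TTS X](card_Zn n_gt1); apply: traceable_of_labels s3 _ _ s_chain.
  by rewrite size_fan_walk card_Zn // /m; lia.
apply: (Zn_pairP n_gt1) => [p q [l1 [l2 [? ? ? ? ?]]]|p d /andP[d_gt0 dn]].
  by exists l1, l2; split=> //; rewrite andbC.
suff [l1 [l2 [l1m l2m n12 H1 H2]]] : fan_covered m c e p (p + d%:R)%R.
  by exists l1, l2; split=> //; apply: s_mem.
(* For [d < h] the difference is a step of each zigzag, for [d = h] the junction step and the spoke
   [c], and for [d > h] a value of [e]. *)
have [ltdh|] := ltnP d h; last rewrite leq_eqVlt => /predU1P[<-|lthd].
- have jh : h.-1 - d < h.-1 by lia.
  have := zigzag_step jh; have -> : h.-1 - (h.-1 - d) = d by lia.
  move=> step; apply: (@fan_cover_steps _ _ _ _ (h.-1 - d) (h + d.-1)); rewrite /m; try lia.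
    by rewrite /e !ifT; lia.
  rewrite /e !ifF /m; try lia.
  have -> : (2 * h).-1 - (h + d.-1) = (h.-1 - d).+1 by lia.
  have -> : (2 * h).-1 - (h + d.-1).+1 = h.-1 - d by lia.
  by lia.
- have hm : h.-1 < m by rewrite /m; lia.
  have mid : e h.-1.+1 = e h.-1 + h.
    rewrite /e ifF ?ifT /m; try lia.
    by have -> : (2 * h).-1 - h.-1.+1 = h.-1; lia.
  have [y Hy] := fan_block_step c p hm (or_introl mid).
  rewrite prednK // in Hy; exists (h, y), (0, p + h%:R)%R; split=> //=; first by rewrite /m; lia.
    by rewrite xpair_eqE; case: (h) h_gt0.
  have -> : (p + h%:R + c%:R = p)%R.
    by rewrite -addrA -natrD -[RHS]addr0 -(Zn_natn n_gt1); congr (_ + _%:R)%R; rewrite /c; lia.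
  by rewrite !inE !eqxx !orbT.
have [d2h|d2h] := leqP d (2 * h).
  have [|j jh zj] := @zigzag_surj h.-1 (d - h - 1); first by lia.
  have <- : e j = d by rewrite /e ifT; lia.
  by apply: cov_e; rewrite /m; lia.
have [|j jh zj] := @zigzag_surj h.-1 (d - 2 * h - 1); first by lia.
have <- : e (m - j) = d.
  by rewrite /e ifF; [rewrite subKn; lia | rewrite /m; lia].
by apply: cov_e; rewrite /m; lia.
Qed.

End OrderOneModSix.

(** * Orders 0 mod 6: fans and a point at infinity *)

Lemma adjacent_Some (V : finType) (L : eqType) (blk : L -> {set V}) l l' :
  adjacent blk l l' = adjacent (fun l => [set Some x | x in blk l]) l l'.
Proof.
rewrite /adjacent -imsetI ?card_imset //; first exact: Some_inj.
by move=> x y _ _ [].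
Qed.

Section OrderZeroModSix.
Variables a b h n : nat.
Hypothesis abE : a = b \/ a = b + 1.
Hypothesis hE : h = a + b + 1.
Hypothesis nE : n = 6 * h - 1.
Let m := 2 * h - 2.
(** A zigzag through [[h, h + 2a - 1]], then a reversed one through [[h + 2a, 3h - 2]]. Step lengths
    are [2a - 1, ..., 1], then [h - 1] at the junction if [h > 1], then [1, ..., 2b]. *)
Let e j :=
  if j < 2 * a then h + zigzag (2 * a).-1 j
  else h + 2 * a + zigzag (2 * b) (m - j).
(** Modulo [n] this is [d] if [a = b] and [- d] if [a = b + 1]. *)
Let c := 2 * h + 2 * a.
Let u := 5 * h - 1.
Let d := 3 * h - 1.

Let mE : m = 2 * a + 2 * b. Proof. by rewrite /m; lia. Qed.
Let n_gt1 : 1 < n. Proof. by lia. Qed.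

Let e_range j : j <= m ->
  if j < 2 * a then h <= e j < h + 2 * a else h + 2 * a <= e j <= 3 * h - 2.
Proof.
rewrite /e => jm; case: (ltnP j (2 * a)) => ja.
  by have := @zigzag_le (2 * a).-1 j; lia.
by have := @zigzag_le (2 * b) (m - j); lia.
Qed.

Let e_inj i j : i <= m -> j <= m -> e i = e j -> i = j.
Proof.
move=> im jm; have := e_range im; have := e_range jm.
rewrite /e; case: (ltnP j (2 * a)) => ja; case: (ltnP i (2 * a)) => ia ? ? E; try lia.
  by apply: (@zigzag_inj (2 * a).-1); lia.
suff : m - i = m - j by lia.
by apply: (@zigzag_inj (2 * b)); lia.
Qed.

Let e_m : e m = h + 2 * a. Proof. by rewrite /e subnn addn0 ifF; lia. Qed.
Let e_0 : e 0 = h.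
Proof.
rewrite /e; case: ltnP => a0; first by rewrite addn0.
have -> : m = 0 by lia.
by have := @zigzag_le (2 * b) (0 - 0); lia.
Qed.

Let low s : 0 < s <= (2 * a).-1 ->
  let i := (2 * a).-1 - s in e i.+1 = e i + s \/ e i = e i.+1 + s.
Proof.
move=> sa; have := @zigzag_step (2 * a).-1 ((2 * a).-1 - s).
have -> : (2 * a).-1 - ((2 * a).-1 - s) = s by lia.
by rewrite /e !ifT; lia.
Qed.

Let up s : 0 < s <= 2 * b ->
  let i := 2 * a + s.-1 in e i.+1 = e i + s \/ e i = e i.+1 + s.
Proof.
move=> sb; have := @zigzag_step (2 * b) (2 * b - s).
have -> : 2 * b - (2 * b - s) = s by lia.
rewrite /e !ifF; try lia.
have -> : m - (2 * a + s.-1) = (2 * b - s).+1 by lia.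
have -> : m - (2 * a + s.-1).+1 = 2 * b - s by lia.
by lia.
Qed.

Let mid : 1 < h -> e (2 * a).-1.+1 = e (2 * a).-1 + h.-1.
Proof.
move=> h_gt1; rewrite /e ifF ?ifT; try lia.
have -> : m - (2 * a).-1.+1 = 2 * b by lia.
by rewrite !zigzag_last !uphalf_half; lia.
Qed.

(** Both zigzags contain all lengths up to [h - 2]. Length [h - 1] occurs at the junction and once
    more in the longer zigzag, which is the second if [a = b] and the first otherwise. *)
Let two_steps s : 0 < s < h -> exists i j, [/\ i < m, j < m, i != j,
  e i.+1 = e i + s \/ e i = e i.+1 + s & e j.+1 = e j + s \/ e j = e j.+1 + s].
Proof.
move=> /andP[s_gt0 s_h]; have [s2|s2] := leqP s (h - 2).
  exists ((2 * a).-1 - s), (2 * a + s.-1).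
  by split; [lia| lia| lia| apply: low; lia| apply: up; lia].
have sE : s = h.-1 by clear -s2 s_h; lia.
have h_gt1 : 1 < h by clear -s_gt0 s_h; lia.
have midstep : e (2 * a).-1.+1 = e (2 * a).-1 + s by rewrite sE; apply: mid.
case: abE => ab.
  exists (2 * a).-1, (2 * a + s.-1).
  by split; [lia| lia| lia| left| apply: up; lia].
exists (2 * a).-1, ((2 * a).-1 - s).
by split; [lia| lia| lia| left| apply: low; lia].
Qed.

Let e_surj k : h <= k < d -> exists2 j, j <= m & e j = k.
Proof.
rewrite /d => /andP[hk kd]; have [ka|ka] := ltnP k (h + 2 * a).
  have [|j jh zj] := @zigzag_surj (2 * a).-1 (k - h); first by lia.
  by exists j; [lia | rewrite /e ifT; lia].
have [|j jh zj] := @zigzag_surj (2 * b) (k - h - 2 * a); first by lia.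
exists (m - j); first by lia.
by rewrite /e ifF; [rewrite subKn|]; lia.
Qed.

Let fblk := @fan_block n c e.
Let blk (l : (nat * 'Z_n) + 'Z_n) : {set option 'Z_n} :=
  match l with
  | inl l => [set Some x | x in fblk l]
  | inr y => [set None; Some y; Some (y + d%:R)%R]
  end.

Lemma traceable_TTS_0mod6 : traceable_TTS n.+1.
Proof.
have e_bound j : j <= m -> 0 < e j < n.
  by move=> /e_range; case: ifP; lia.
have c_bound : 0 < c < n by rewrite /c; lia.
have u_bound : 0 < u < n by rewrite /u; lia.
have c_notin j : j <= m -> e j <> c.
  by move=> /e_range; rewrite /c; case: ifP; lia.
have u_notin j : j <= m -> e j <> u.
  by move=> /e_range; rewrite /u; case: ifP; lia.
have c_neq_u : c <> u by rewrite /c /u; lia.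
have Zn1 i j : i = j + n -> (i%:R = j%:R :> 'Z_n)%R.
  by move->; rewrite natrD Zn_natn // addr0.
have closing : (u%:R + c%:R = 0 :> 'Z_n /\ u%:R + (e 0)%:R = (e m)%:R :> 'Z_n)%R \/
  (u%:R + (e 0)%:R = 0 :> 'Z_n /\ u%:R + c%:R = (e m)%:R :> 'Z_n)%R.
  right; rewrite e_m e_0 -!natrD; split; last by apply: Zn1; rewrite /u /c; lia.
  by apply: (Zn1 _ 0); rewrite /u; lia.
(* Here [6 * u + 1 = 5 * n]; likewise [2 * d + 1 = n] below makes [d] a unit, so that the blocks at
   infinity form a single cycle. *)
have uw : (u%:R * - 6%:R = 1 :> 'Z_n)%R.
  rewrite mulrN -natrM; apply/eqP; rewrite eqr_oppLR -addr_eq0 natr1; apply/eqP.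
  rewrite -(mul0r 5%:R)%R -(Zn_natn n_gt1) -natrM; congr (_%:R)%R.
  by rewrite /u; lia.
have dw : (d%:R * - 2%:R = 1 :> 'Z_n)%R.
  rewrite mulrN -natrM; apply/eqP; rewrite eqr_oppLR -addr_eq0 natr1; apply/eqP.
  by rewrite -(Zn_natn n_gt1); congr (_%:R)%R; rewrite /d; lia.
have [s3 s_mem s_chain cov_e] :=
  fan_walkP n_gt1 e_bound e_inj c_bound u_bound c_notin u_notin c_neq_u closing uw.
(* The cycle is started so that its last block contains 0 and [c], an edge of the first fan
   block. *)
pose t : 'Z_n := (if a == b then d%:R else 0)%R.
pose s1 := walk d%:R%R (fun y : 'Z_n => [:: inr (y + t)%R : (nat * 'Z_n) + 'Z_n]).
pose s := s1 ++ [seq inl l | l <- fan_walk n m u].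
have inr_mem y : inr y \in s.
  rewrite mem_cat; apply/orP; left.
  by apply: (mem_walk n_gt1 dw (y := (y - t)%R)); rewrite inE subrK.
have inl_mem l : l.1 <= m -> inl l \in s.
  by move/s_mem => ls; rewrite mem_cat; apply/orP; right; apply: map_f.
have d_neq (y : 'Z_n) : (y != y + d%:R)%R by apply: add_natr_neq; rewrite // /d; lia.
have blk3 l : l \in s -> #|blk l| = 3.
  rewrite mem_cat => /orP[/mem_walkP[y]|/mapP[k ks ->]].
    rewrite inE => /eqP->; apply: card_set3 => //.
    by rewrite (inj_eq Some_inj).
  by rewrite card_imset; [apply: s3 | apply: Some_inj].
have cE : a = b -> c = d by rewrite /c /d; lia.
have inr_3 y : #|blk (inr y)| = 3 by apply: blk3.
have inr_adj y : adjacent blk (inr y) (inr (y + d%:R)%R).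
  apply: (@card_setI3 _ _ _ None (Some (y + d%:R)%R) (Some y)) => //;
    rewrite ?subUset ?sub1set ?inE ?eqxx ?orbT //.
  rewrite negb_or negb_or !(inj_eq Some_inj) d_neq -addrA -natrD /=.
  by apply: add_natr_neq; rewrite // /d; lia.
have s_chain1 : chain (adjacent blk) (inr t) (inr (- d%:R + t)%R) s1.
  have := @chain_walk n n_gt1 _ d%:R%R _ (adjacent blk) (fun y => inr (y + t)%R) (fun y => inr (y + t)%R).
  rewrite add0r; apply => y; first exact: chain1.
  by rewrite addrAC; apply: inr_adj.
have s_chain2 : chain (adjacent blk) (inr t) (inl (m, - u%:R)%R) s.
  apply: (chain_cat s_chain1); last first.
    by apply: chain_map s_chain => l l'; rewrite adjacent_Some.
  have c_in : ([set Some (0 : 'Z_n); Some c%:R] \subset blk (inr (- d%:R + t)))%R.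
    rewrite subUset !sub1set !inE /t; case: ifP => /eqP ab.
      by rewrite addNr add0r (cE ab) !eqxx !orbT.
    rewrite addr0 addNr eqxx orbT /=; suff -> : (c%:R = - d%:R :> 'Z_n)%R by rewrite eqxx.
    apply/eqP; rewrite -addr_eq0 -natrD; apply/eqP.
    by rewrite -(Zn_natn n_gt1); congr (_%:R)%R; rewrite /c /d; lia.
  apply: (@card_setI3 _ _ _ (Some (0 : 'Z_n)%R) (Some c%:R)%R None) => //.
  - by apply: blk3; rewrite inl_mem.
  - by rewrite (inj_eq Some_inj) -[c%:R%R]add0r add_natr_neq.
  - by rewrite subUset !sub1set !mem_imset; try exact: Some_inj; rewrite /= !inE !add0r !eqxx !orbT.
  - by rewrite !inE.
  - by apply/imsetP; case.
have cV : #|{: option 'Z_n}| = n.+1 by rewrite card_option card_Zn.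
rewrite -[X in traceable_TTS X]cV; apply: traceable_of_labels blk3 _ _ s_chain2.
  rewrite cV size_cat size_map size_fan_walk (size_walk _ (m := 1)) // /m; nia.
have cov_None p : exists l1 l2, [/\ l1 \in s, l2 \in s, l1 != l2,
    (None \in blk l1) && (Some p \in blk l1) & (None \in blk l2) && (Some p \in blk l2)].
  exists (inr p), (inr (p - d%:R)%R); split=> //.
  - by have := d_neq (p - d%:R)%R; rewrite subrK eq_sym.
  - by rewrite !inE !eqxx ?orbT.
  by rewrite !inE subrK !eqxx ?orbT.
case=> [p|] [q|] // npq; last first.
  by have [l1 [l2 [? ? ? ? ?]]] := cov_None p; exists l1, l2; split=> //; rewrite andbC.
have {npq} : p != q by apply: contra npq => /eqP->.
move: p q; apply: (Zn_pairP n_gt1) => [p q [l1 [l2 [? ? ? ? ?]]]|p k /andP[k_gt0 kn]].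
  by exists l1, l2; split=> //; rewrite andbC.
(* Since [d = n./2], the remaining case is [k = d]: one block at infinity, and one block 0 through
   its spoke [c], which is [d] or [- d]. *)
have [kd|] := ltnP k d; last first.
  move=> dk; have -> : k = d by move: kn dk; rewrite /d; lia.
  exists (inr p), (inl (0, if a == b then p else (p + d%:R)%R)); split=> //.
  - by apply: inl_mem.
  - by rewrite !inE !eqxx ?orbT.
  rewrite !mem_imset; try exact: Some_inj.
  case: ifP => /eqP ab /=; rewrite !inE.
    by rewrite (cE ab) !eqxx !orbT.
  have -> : (p + d%:R + c%:R = p)%R.
    by rewrite -addrA -natrD -[RHS]addr0 -(Zn_natn n_gt1); congr (_ + _%:R)%R; rewrite /c /d; lia.
  by rewrite !eqxx !orbT.
suff [l1 [l2 [l1m l2m n12 H1 H2]]] : fan_covered m c e p (p + k%:R)%R.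
  exists (inl l1), (inl l2); split; rewrite ?inl_mem // ?mem_imset //; exact: Some_inj.
have [lt_kh|le_hk] := ltnP k h.
  have [|i [j [im jm nij si sj]]] := @two_steps k; first by rewrite k_gt0.
  exact: fan_cover_steps nij si sj.
have [|j jm <-] := @e_surj k; first by rewrite le_hk.
exact: cov_e.
Qed.

End OrderZeroModSix.

(** * Zigzag paths of differences *)

Section DifferencePaths.
Variables N h n : nat.
Hypothesis hE : h = N.+1.
Hypothesis nE : n = (2 * h).+1.

(* Each path runs through all of Z_n, and both its first and its last [h] steps
   have every length 1, ..., h (up to sign) once. *)
Definition dpath0 j := h + zigzag (2 * h) j.
Definition dpath1 j :=
  if j <= h then zigzag h j else h + 1 + zigzag N (2 * h - j).
Definition dpath2 j :=
  if j <= h then zigzag h j else 2 * h - zigzag N (2 * h - j).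

Lemma dpath1_inj i j : i <= 2 * h -> j <= 2 * h -> dpath1 i = dpath1 j -> i = j.
Proof.
move=> ih jh; rewrite /dpath1.
have zi := @zigzag_le h i; have zj := @zigzag_le h j.
case: leqP => hi; case: leqP => hj E; try lia.
  exact: zigzag_inj E.
suff : 2 * h - i = 2 * h - j by lia.
by apply: (@zigzag_inj N); lia.
Qed.

Lemma dpath2_inj i j : i <= 2 * h -> j <= 2 * h -> dpath2 i = dpath2 j -> i = j.
Proof.
move=> ih jh; rewrite /dpath2.
have zi := @zigzag_le h i; have zj := @zigzag_le h j.
have zi' := @zigzag_le N (2 * h - i); have zj' := @zigzag_le N (2 * h - j).
case: leqP => hi; case: leqP => hj E; try lia.
  exact: zigzag_inj E.
suff : 2 * h - i = 2 * h - j by lia.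
by apply: (@zigzag_inj N); lia.
Qed.

Lemma dpath1_le j : j <= 2 * h -> dpath1 j <= 2 * h.
Proof.
move=> jh; rewrite /dpath1; case: (leqP j h) => hj; first by have := zigzag_le hj; lia.
by have := @zigzag_le N (2 * h - j); lia.
Qed.

Lemma dpath2_le j : j <= 2 * h -> dpath2 j <= 2 * h.
Proof.
move=> jh; rewrite /dpath2; case: (leqP j h) => hj; first by have := zigzag_le hj; lia.
by lia.
Qed.

(** Pigeonhole, transferred to a self-map of ['I_M.+1]. *)
Lemma inj_surj_leq (f : nat -> nat) M :
  (forall j, j <= M -> f j <= M) ->
  (forall i j, i <= M -> j <= M -> f i = f j -> i = j) ->
  forall t, t <= M -> exists2 j, j <= M & f j = t.
Proof.
move=> fM f_inj t tM; pose F (i : 'I_M.+1) : 'I_M.+1 := inord (f i).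
have FE i : F i = f i :> nat by rewrite /F inordK // ltnS fM // -ltnS.
have F_inj : injective F.
  move=> i j /(congr1 val); rewrite /= !FE => E; apply: val_inj.
  by apply: f_inj E; rewrite -ltnS.
exists (invF F_inj (inord t)); first by rewrite -ltnS.
by rewrite -FE f_invF inordK.
Qed.

Local Open Scope ring_scope.

Let n_gt1 : (1 < n)%N. Proof. by lia. Qed.

(** The sign on the last path turns its final value into 1, as the transversal blocks require. *)
Definition dpath (i : 'Z_3) (j : nat) : 'Z_n :=
  if i == 0 then (dpath0 j)%:R
  else if i == 1 then (dpath1 j)%:R else - (dpath2 j)%:R.

Lemma dpath_inj i j j' :
  (j <= 2 * h)%N -> (j' <= 2 * h)%N -> dpath i j = dpath i j' -> j = j'.
Proof.
move=> jh jh'; rewrite /dpath; case: (i == 0); last case: (i == 1).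
- rewrite /dpath0 !natrD => /addrI/natr_Zn_inj E.
  by apply: (zigzag_inj jh jh'); apply: E; rewrite // nE ltnS zigzag_le.
- move/natr_Zn_inj => E; apply: (dpath1_inj jh jh').
  by apply: E; rewrite // nE ltnS dpath1_le.
move/oppr_inj/natr_Zn_inj => E; apply: (dpath2_inj jh jh').
by apply: E; rewrite // nE ltnS dpath2_le.
Qed.

Lemma dpath_surj i x : exists2 j, (j <= 2 * h)%N & dpath i j = x.
Proof.
rewrite /dpath; case: (i == 0); last case: (i == 1).
- have [t tn tE] := Zn_val n_gt1 (x - h%:R).
  have [|j jh jt] := @zigzag_surj (2 * h) t; first by rewrite -ltnS -nE.
  by exists j => //; rewrite /dpath0 natrD jt -tE addrC subrK.
- have [t tn tE] := Zn_val n_gt1 x.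
  have [|j jh jt] := inj_surj_leq dpath1_le dpath1_inj (t := t); first by rewrite -ltnS -nE.
  by exists j => //; rewrite jt.
have [t tn tE] := Zn_val n_gt1 (- x).
have [|j jh jt] := inj_surj_leq dpath2_le dpath2_inj (t := t); first by rewrite -ltnS -nE.
by exists j => //; rewrite jt -tE opprK.
Qed.

Definition is_step i j (d : nat) :=
  dpath i j.+1 = dpath i j + d%:R \/ dpath i j = dpath i j.+1 + d%:R.

Let Zn_eq0 k : k = n -> k%:R = 0 :> 'Z_n.
Proof. by move->; apply: Zn_natn. Qed.

Let opp_natr k d : (k + d)%N = n -> k%:R = - d%:R :> 'Z_n.
Proof. by move=> E; apply/eqP; rewrite -addr_eq0 -natrD Zn_eq0. Qed.

Lemma step_low i d : (0 < d <= h)%N -> exists2 j, (j < h)%N & is_step i j d.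
Proof.
move=> /andP[d0 dh]; rewrite /is_step /dpath; case: (i == 0); last case: (i == 1).
(* This integer jump has length [n - d], hence difference [d] up to sign in ['Z_n]. *)
- exists d.-1; first by lia.
  rewrite /dpath0; have [|->|->] := @zigzag_step (2 * h) d.-1; first by lia.
    by right; rewrite addnA (natrD _ _ (2 * h - d.-1)) (@opp_natr (2 * h - d.-1) d) ?subrK //; lia.
  by left; rewrite addnA (natrD _ _ (2 * h - d.-1)) (@opp_natr (2 * h - d.-1) d) ?subrK //; lia.
- exists (h - d)%N; first by lia.
  have := @zigzag_step h (h - d); rewrite /dpath1 !ifT; try lia.
  have -> : (h - (h - d) = d)%N by lia.
  by case=> [|->|->]; [lia| left| right]; rewrite natrD.
exists (h - d)%N; first by lia.
have := @zigzag_step h (h - d); rewrite /dpath2 !ifT; try lia.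
have -> : (h - (h - d) = d)%N by lia.
by case=> [|->|->]; [lia| right| left]; rewrite natrD opprD ?subrK.
Qed.

Lemma step_high i d : (0 < d <= h)%N ->
  exists2 j, (h <= j < 2 * h)%N & is_step i j d.
Proof.
move=> /andP[d0 dh]; rewrite /is_step /dpath; case: (i == 0); last case: (i == 1).
- exists (2 * h - d)%N; first by lia.
  have := @zigzag_step (2 * h) (2 * h - d); rewrite /dpath0.
  have -> : (2 * h - (2 * h - d) = d)%N by lia.
  by case=> [|->|->]; [lia| left| right]; rewrite addnA natrD.
(* Length [h] is the jump between the two zigzags of the path; it is [h] or [h + 1 = - h] according
   to the parity of [h]. *)
- move: dh; rewrite leq_eqVlt => /predU1P[->|dh].
    exists h; first by lia.
    rewrite /dpath1 ltnn leqnn.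
    have -> : (2 * h - h.+1 = N)%N by lia.
    have := zigzag_last N; have := zigzag_last h; rewrite !uphalf_half => -> ->.
    have [o|o] := boolP (odd h).
      by left; rewrite -natrD; congr (_%:R); lia.
    right; rewrite -natrD -[LHS]addr0 -(Zn_natn n_gt1) -natrD; congr (_%:R); lia.
  exists (h + d)%N; first by lia.
  have := @zigzag_step N (N - d); rewrite /dpath1 !ifF; try lia.
  have -> : (2 * h - (h + d) = (N - d).+1)%N by lia.
  have -> : (2 * h - (h + d).+1 = N - d)%N by lia.
  have -> : (N - (N - d) = d)%N by lia.
  by case=> [|->|->]; [lia| right| left]; rewrite addnA natrD.
move: dh; rewrite leq_eqVlt => /predU1P[->|dh].
  exists h; first by lia.
  rewrite /dpath2 ltnn leqnn.
  have -> : (2 * h - h.+1 = N)%N by lia.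
  have := zigzag_last N; have := zigzag_last h; rewrite !uphalf_half => -> ->.
  right; have -> : (2 * h - (odd N + N./2) = odd h + h./2 + h)%N by lia.
  by rewrite (natrD _ _ h) opprD subrK.
exists (h + d)%N; first by lia.
have := @zigzag_step N (N - d); rewrite /dpath2 !ifF; try lia.
have -> : (2 * h - (h + d) = (N - d).+1)%N by lia.
have -> : (2 * h - (h + d).+1 = N - d)%N by lia.
have -> : (N - (N - d) = d)%N by lia.
have zle1 : (zigzag N (N - d) <= N)%N by apply: zigzag_le; lia.
have zle2 : (zigzag N (N - d).+1 <= N)%N by apply: zigzag_le; lia.
case=> [|E|E]; [lia| right | left].
  have -> : (2 * h - zigzag N (N - d) = 2 * h - zigzag N (N - d).+1 + d)%N by lia.
  by rewrite natrD opprD subrK.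
have -> : (2 * h - zigzag N (N - d).+1 = 2 * h - zigzag N (N - d) + d)%N by lia.
by rewrite natrD opprD subrK.
Qed.

(** An end difference lies in only one path block, so a transversal block must supply the second.
    The six ends split into two triples with sum 0 around the levels: [-1, 0, 1] for the blocks
    [inr z], and [h, h + 1, 0] for the columns. *)
Lemma dpath_ends :
  [/\ dpath 0 0 = h%:R, dpath 0 (2 * h) = -1,
      dpath 1 0 = 0 /\ dpath 1 (2 * h) = h%:R + 1
    & dpath (1 + 1) 0 = 0 /\ dpath (1 + 1) (2 * h) = 1].
Proof.
have Z2h : (2 * h)%:R = -1 :> 'Z_n by apply: (@opp_natr _ 1); lia.
rewrite /dpath /=; split=> //=.
- by rewrite /dpath0 addn0.
- by rewrite /dpath0 zigzag_last uphalf_half -Z2h; congr (_%:R); lia.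
- split=> //; rewrite /dpath1 ifF; last by lia.
  by rewrite subnn addn0 natrD.
split; first by rewrite oppr0.
by rewrite /dpath2 ifF ?subnn ?subn0 ?Z2h ?opprK //; lia.
Qed.

(* The values met where the walk leaves one path for another. *)
Lemma dpath_turns :
  [/\ dpath 0 h = h%:R + (zigzag (2 * h) h)%:R /\ dpath 0 (2 * h).-1 = 0,
      dpath 1 N = (if odd h then h./2 else h./2.+1)%:R,
      dpath 1 h = (uphalf h)%:R /\ dpath 1 h.+1 = h%:R + 1 + (h./2)%:R
    & dpath (1 + 1) h = - (uphalf h)%:R /\ dpath (1 + 1) 1 = - h%:R].
Proof.
rewrite /dpath /=; split=> //=.
- split; first by rewrite /dpath0 natrD.
  apply: Zn_eq0; rewrite /dpath0 /zigzag.
  have -> : odd (2 * h).-1 by lia.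
  by lia.
- congr (_%:R); rewrite /dpath1 ifT; last by lia.
  rewrite /zigzag hE /= uphalf_half; have [o|o] := boolP (odd N) => /=; lia.
- rewrite /dpath1 leqnn ltnn zigzag_last; split=> //.
  have -> : (2 * h - h.+1 = N)%N by lia.
  by rewrite zigzag_last hE /= !natrD.
rewrite /dpath2 leqnn zigzag_last; split=> //.
by rewrite ifT /zigzag /= ?subn0 //; lia.
Qed.

End DifferencePaths.

(** * Three cyclic levels *)

Lemma Z3_neq (i : 'Z_3) :
  [/\ (i + 1 == i) = false, (i == i + 1) = false,
      (i + 1 + 1 == i) = false & (i == i + 1 + 1) = false]%R.
Proof. by case: i => [[|[|[|]]]]. Qed.

Lemma Z3_levels (i j : 'Z_3) : i != j -> (j = i + 1 \/ i = j + 1)%R.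
Proof.
by case: i => [[|[|[|]]]] // ?; case: j => [[|[|[|]]]] // ? _;
  (left; exact: val_inj) || (right; exact: val_inj).
Qed.

Lemma Z3_cases (i : 'Z_3) : (i = 0 \/ i = 1 \/ i = 1 + 1)%R.
Proof.
by case: i => [[|[|[|]]]] // ?; [left|right; left|right; right]; exact: val_inj.
Qed.

Lemma adjacent_sym (V : finType) (L : eqType) (blk : L -> {set V}) :
  symmetric (adjacent blk).
Proof. by move=> l l'; rewrite /adjacent setIC. Qed.

Section ThreeLevels.
Local Open Scope ring_scope.
Variables N h n : nat.
Hypothesis hE : h = N.+1.
Hypothesis nE : n = (2 * h).+1.

Let n_gt1 : (1 < n)%N. Proof. by lia. Qed.
Let g := dpath N h n.
Let point := ('Z_n * 'Z_3)%type.

Let g_inj i j j' :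
  (j <= 2 * h)%N -> (j' <= 2 * h)%N -> g i j = g i j' -> j = j'.
Proof. exact: dpath_inj. Qed.

(* [inl (i, j, c)] is step [j] of the path between levels [i] and [i + 1];
   [inr z] and [column y] are the transversal blocks closing the paths. *)
Definition level_block (l : ('Z_3 * nat * 'Z_n) + 'Z_n) : {set point} :=
  match l with
  | inl (i, j, c) =>
      if (j < h)%N then [set (c, i + 1); (c - g i j, i); (c - g i j.+1, i)]
      else [set (c, i); (c + g i j, i + 1); (c + g i j.+1, i + 1)]
  | inr z => [set (z, 0); (z - 1, 1); (z - 1, 1 + 1)]
  end.

Definition column (y : 'Z_n) : {set point} :=
  [set (y, 0); (y + h%:R, 1); (y, 1 + 1)].

Definition level_label (l : ('Z_3 * nat * 'Z_n) + 'Z_n) : bool :=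
  if l is inl (i, j, c) then (j < 2 * h)%N else true.

Let pE := (xpair_eqE, eqxx, andbT, andbF, andTb, orbT, orbF).

Lemma card_column y : #|column y| = 3%N.
Proof. by apply: card_set3; rewrite !pE. Qed.

Lemma card_level_block l : level_label l -> #|level_block l| = 3%N.
Proof.
case: l => [[[i j] c]|z] /= jh; last by apply: card_set3; rewrite !pE.
have [n1 n2 n3 n4] := Z3_neq i.
have gj : g i j != g i j.+1.
  by apply/eqP => /g_inj E; have := E (ltnW jh) jh; lia.
case: ifP => _; apply: card_set3; rewrite !pE ?n1 ?n2 ?andbF //.
  by rewrite (inj_eq (addrI c)) (inj_eq oppr_inj).
by rewrite (inj_eq (addrI c)).
Qed.

Let adj := adjacent level_block.

Lemma adj_fan i j c : (j.+1 < 2 * h)%N -> (j.+1 < h)%N || (h <= j)%N ->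
  adj (inl (i, j, c)) (inl (i, j.+1, c)).
Proof.
move=> jh side; have [n1 n2 n3 n4] := Z3_neq i.
have gN a b : (a <= 2 * h)%N -> (b <= 2 * h)%N -> a <> b -> (g i a == g i b) = false.
  by move=> ah bh ab; apply/eqP => /g_inj E; apply/ab/E.
have c1 := @card_level_block (inl (i, j, c)) (ltnW jh).
have c2 := @card_level_block (inl (i, j.+1, c)) jh.
case/orP: side => hj.
  have [hj1 hj2] : (j < h)%N /\ (j.+1 < h)%N by lia.
  apply: (@card_setI3 _ _ _ (c, i + 1) (c - g i j.+1, i) (c - g i j, i)) => //;
    rewrite /level_block /= ?hj1 ?hj2 ?subUset ?sub1set ?inE ?pE ?n1 ?n2 ?pE //.
  by rewrite !(inj_eq (addrI c)) !(inj_eq oppr_inj) !gN //; lia.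
have [hj1 hj2] : (j < h)%N = false /\ (j.+1 < h)%N = false by lia.
apply: (@card_setI3 _ _ _ (c, i) (c + g i j.+1, i + 1) (c + g i j, i + 1)) => //;
  rewrite /level_block /= ?hj1 ?hj2 ?subUset ?sub1set ?inE ?pE ?n1 ?n2 ?pE //.
by rewrite !(inj_eq (addrI c)) !gN //; lia.
Qed.

(** The blocks share the edge of difference [g i h]; crossing it moves the centre from level [i + 1]
    down to level [i]. *)
Lemma adj_middle i c : adj (inl (i, N, c)) (inl (i, h, c - g i h)).
Proof.
have [n1 n2 n3 n4] := Z3_neq i.
have c1 := @card_level_block (inl (i, N, c)).
have c2 := @card_level_block (inl (i, h, c - g i h)).
have hN : (N < h)%N by lia.
apply: (@card_setI3 _ _ _ (c, i + 1) (c - g i h, i) (c - g i N, i)).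
- by apply: c1 => /=; lia.
- by apply: c2 => /=; lia.
- by rewrite !pE n1 andbF.
- by rewrite /level_block hN subUset !sub1set !inE -hE !pE.
- by rewrite /level_block ltnn subUset !sub1set !inE subrK !pE.
- by rewrite /level_block hN !inE !pE.
rewrite /level_block ltnn !inE !pE n2 !andbF !orbF (inj_eq (addrI c)) (inj_eq oppr_inj).
apply/eqP => /g_inj E; have EN : N = h by apply: E; lia.
by lia.
Qed.

(** Upper blocks of path [i] and lower blocks of path [i + 1] have an edge inside level [i + 1]; the
    walk can change path where these edges coincide, in either orientation. *)
Lemma adj_rung i j j' c c' : (h <= j < 2 * h)%N -> (j' < h)%N ->
  (c + g i j = c' - g (i + 1) j' /\ c + g i j.+1 = c' - g (i + 1) j'.+1) \/
  (c + g i j = c' - g (i + 1) j'.+1 /\ c + g i j.+1 = c' - g (i + 1) j') ->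
  adj (inl (i, j, c)) (inl (i + 1, j', c')).
Proof.
move=> /andP[hj jh] jh' E; have [n1 n2 n3 n4] := Z3_neq i.
have c1 := @card_level_block (inl (i, j, c)) jh.
have c2 := @card_level_block (inl (i + 1, j', c')).
have hjF : (j < h)%N = false by lia.
apply: (@card_setI3 _ _ _ (c + g i j, i + 1) (c + g i j.+1, i + 1) (c, i)) => //.
- by apply: c2 => /=; lia.
- rewrite !pE (inj_eq (addrI c)); apply/eqP => /g_inj Ej.
  have EN : j = j.+1 by apply: Ej; lia.
  by lia.
- by rewrite /level_block hjF subUset !sub1set !inE !pE.
- by rewrite /level_block jh' subUset !sub1set !inE; case: E => [[-> ->]|[-> ->]]; rewrite !pE.
- by rewrite /level_block hjF !inE !pE.
by rewrite /level_block jh' !inE !pE n2 n4 !andbF.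
Qed.

Let gends := dpath_ends hE nE.
Let gturns := dpath_turns hE nE.

Let Zn2h : 2%:R * h%:R + 1 = 0 :> 'Z_n.
Proof. by rewrite -natrM natr1 -(Zn_natn n_gt1); congr (_%:R); rewrite nE. Qed.

Let h_half : h%:R = 2%:R * (h./2)%:R + (odd h)%:R :> 'Z_n.
Proof. by rewrite -natrM -natrD; congr (_%:R); lia. Qed.

Lemma adj_1_Q c : adj (inl (1, 0%N, c)) (inr (c + 1)).
Proof.
have [_ _ [g0 _] _] := gends; rewrite -/g in g0.
have h0 : (0 < h)%N by lia.
apply: (@card_setI3 _ _ _ (c, 1) (c, 1 + 1) (c - g 1 1, 1)).
- by apply: card_level_block => /=; lia.
- exact: card_level_block.
- by rewrite !pE.
- by rewrite /level_block h0 subUset !sub1set !inE g0 subr0 !pE.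
- by rewrite /level_block subUset !sub1set !inE addrK !pE.
- by rewrite /level_block h0 !inE !pE.
rewrite /level_block !inE addrK !pE /= ?orbF.
rewrite -{2}[c]subr0 -g0 (inj_eq (addrI c)) (inj_eq oppr_inj).
by apply/eqP => /g_inj E; have E1 : 1%N = 0%N by [apply: E; lia].
Qed.

Let e3 : 1 + 1 + 1 = 0 :> 'Z_3. Proof. exact: val_inj. Qed.

Lemma adj_Q_2 c : adj (inr (c + 1)) (inl (1 + 1, (h + N)%N, c)).
Proof.
have [_ _ _ [_ g1]] := gends; rewrite -/g in g1.
have hN : (h + N < h)%N = false by lia.
have EN : (h + N).+1 = (2 * h)%N by lia.
apply: (@card_setI3 _ _ _ (c + 1, 0) (c, 1 + 1) (c, 1)).
- exact: card_level_block.
- by apply: card_level_block => /=; lia.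
- by rewrite !pE.
- by rewrite /level_block subUset !sub1set !inE addrK !pE.
- by rewrite /level_block hN EN g1 e3 subUset !sub1set !inE !pE.
- by rewrite /level_block !inE addrK !pE.
by rewrite /level_block hN e3 !inE !pE.
Qed.

(* One turn of the walk starting at [column y] follows path 0 forwards, the first
   half of path 1 backwards, path 2 backwards and the second half of path 1
   forwards; the turns are the offsets from [y] of the centres of its pieces. *)
Definition turn1 : 'Z_n := - (zigzag (2 * h) h)%:R.
Definition turn2 : 'Z_n := turn1 + (h./2)%:R.
Definition turn3 : 'Z_n := turn2 - (uphalf h)%:R.
Definition turn4 : 'Z_n :=
  turn3 + (if odd h then - (uphalf h)%:R else (h./2)%:R).

Definition level_walk (y : 'Z_n) : seq (('Z_3 * nat * 'Z_n) + 'Z_n) :=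
  [seq inl (0, j, y + h%:R) | j <- iota 0 N.+1] ++
  [seq inl (0, (h + j)%N, y + turn1) | j <- iota 0 N.+1] ++
  [seq inl (1, (N - j)%N, y + turn2) | j <- iota 0 N.+1] ++
  [:: inr (y + turn2 + 1)] ++
  [seq inl (1 + 1, (h + (N - j))%N, y + turn2) | j <- iota 0 N.+1] ++
  [seq inl (1 + 1, (N - j)%N, y + turn3) | j <- iota 0 N.+1] ++
  [seq inl (1, (h + j)%N, y + turn4) | j <- iota 0 N.+1].

Lemma level_walk_chain y :
  chain adj (inl (0, 0%N, y + h%:R)) (inl (1, (h + N)%N, y + turn4)) (level_walk y).
Proof.
have lowU i c : chain adj (inl (i, 0%N, c)) (inl (i, N, c))
    [seq inl (i, j, c) | j <- iota 0 N.+1].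
  by apply: (chain_iota (f := fun j => inl (i, j, c))) => j jN; apply: adj_fan; lia.
have highU i c : chain adj (inl (i, h, c)) (inl (i, (h + N)%N, c))
    [seq inl (i, (h + j)%N, c) | j <- iota 0 N.+1].
  have := @chain_iota _ adj (fun j => inl (i, (h + j)%N, c)) N.
  rewrite addn0; apply=> j jN.
  by rewrite addnS; apply: adj_fan; lia.
have lowD i c : chain adj (inl (i, N, c)) (inl (i, 0%N, c))
    [seq inl (i, (N - j)%N, c) | j <- iota 0 N.+1].
  have := @chain_iota _ adj (fun j => inl (i, (N - j)%N, c)) N.
  rewrite subn0 subnn; apply=> j jN.
  have -> : (N - j = (N - j.+1).+1)%N by lia.
  by rewrite /adj adjacent_sym; apply: adj_fan; lia.
have highD i c : chain adj (inl (i, (h + N)%N, c)) (inl (i, h, c))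
    [seq inl (i, (h + (N - j))%N, c) | j <- iota 0 N.+1].
  have := @chain_iota _ adj (fun j => inl (i, (h + (N - j))%N, c)) N.
  rewrite subn0 subnn addn0; apply=> j jN.
  have -> : (h + (N - j) = (h + (N - j.+1)).+1)%N by lia.
  by rewrite /adj adjacent_sym; apply: adj_fan; lia.
have [ge00 ge0h [ge10 ge1h] [ge20 ge2h]] := gends.
have [[gt0h gt0l] gt1N [gt1h gt1h1] [gt2h gt21]] := gturns.
rewrite -?/g in ge00 ge0h ge10 ge1h ge20 ge2h gt0h gt0l gt1N gt1h gt1h1 gt2h gt21.
have hup : uphalf h = (odd h + h./2)%N by rewrite uphalf_half.
refine (chain_cat (lowU _ _) _ (chain_cat (highU _ _) _
  (chain_cat (lowD _ _) _ (chain_cat (chain1 _ _) _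
  (chain_cat (highD _ _) _ (chain_cat (lowD _ _) _ (highU _ _))))))).
- have -> : y + turn1 = y + h%:R - g 0 h by rewrite gt0h /turn1; ring.
  exact: adj_middle.
(* The last step of path 0 and step [N] of path 1 both have length 1. *)
- have -> : 1 = 0 + 1 :> 'Z_3 by rewrite add0r.
  apply: adj_rung; try lia.
  have -> : (h + N).+1 = (2 * h)%N by lia.
  have -> : (h + N)%N = (2 * h).-1 by lia.
  rewrite ge0h gt0l add0r -hE gt1N gt1h hup /turn2.
  case: (odd h); [left | right]; split; rewrite ?natrD -?natr1; ring.
- exact: adj_1_Q.
- exact: adj_Q_2.
- have -> : y + turn2 = y + turn3 - g (1 + 1) h by rewrite gt2h /turn3; ring.
  by rewrite /adj adjacent_sym; apply: adj_middle.
(* Step [h] of path 1 and step 0 of path 2 both have length [h] up to sign. *)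
rewrite /adj adjacent_sym; apply: adj_rung; try lia.
rewrite gt1h gt1h1 ge20 gt21 /turn4 hup.
have Eh := h_half; have E0 := Zn2h.
case: (odd h) Eh => Eh; [left | right]; split; rewrite ?natrD /=; try by ring.
  by rewrite Eh /=; ring.
by apply/eqP; rewrite -subr_eq0; apply/eqP; rewrite -[RHS]E0 Eh /=; ring.
Qed.

Lemma size_level_walk y : size (level_walk y) = (6 * h + 1)%N.
Proof. by rewrite /level_walk !size_cat !size_map !size_iota /=; lia. Qed.

Lemma level_walk_label y l : l \in level_walk y -> level_label l.
Proof.
move: l; apply/allP.
have seg (f : nat -> ('Z_3 * nat * 'Z_n) + 'Z_n) : (forall j, (j < h)%N -> level_label (f j)) ->
    all level_label [seq f j | j <- iota 0 N.+1].
  by move=> fP; apply/allP => _ /mapP[j jN ->]; apply: fP; rewrite mem_iota in jN; lia.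
by rewrite /level_walk !all_cat !seg //= => j; lia.
Qed.

Lemma mem_level_walk l : level_label l -> exists y, l \in level_walk y.
Proof.
have In (f : nat -> ('Z_3 * nat * 'Z_n) + 'Z_n) k x : (k < h)%N -> f k = x ->
    x \in [seq f j | j <- iota 0 N.+1].
  by move=> kh <-; apply: map_f; rewrite mem_iota -hE.
case: l => [[[i j] c]|z] /= jh; last first.
  exists (z - turn2 - 1); have E : z - turn2 - 1 + turn2 + 1 = z by ring.
  by rewrite /level_walk E !mem_cat mem_head !orbT.
have [jlt|jge] := ltnP j h; case: (Z3_cases i) => [->|[->|->]].
- exists (c - h%:R); rewrite /level_walk !mem_cat subrK; apply/orP; left.
  exact: (In _ j).
- exists (c - turn2); rewrite /level_walk !mem_cat subrK.
  do 2![apply/orP; right]; apply/orP; left.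
  by apply: (In _ (N - j)%N); [|rewrite subKn //]; lia.
- exists (c - turn3); rewrite /level_walk !mem_cat subrK.
  do 5![apply/orP; right]; apply/orP; left.
  by apply: (In _ (N - j)%N); [|rewrite subKn //]; lia.
- exists (c - turn1); rewrite /level_walk !mem_cat subrK.
  apply/orP; right; apply/orP; left.
  by apply: (In _ (j - h)%N); [lia|rewrite subnKC].
- exists (c - turn4); rewrite /level_walk !mem_cat subrK; do 6![apply/orP; right].
  by apply: (In _ (j - h)%N); [lia|rewrite subnKC].
exists (c - turn2); rewrite /level_walk !mem_cat subrK.
do 4![apply/orP; right]; apply/orP; left.
have jE : (h + (N - (h + N - j)) = j)%N by lia.
by apply: (In _ (h + N - j)%N); [lia|rewrite jE].
Qed.

(** Path 1 ends at [h + 1 = - h], so the last block, centred at [y + turn4], borders the column at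
    [y + turn4 - h]. *)
Definition speed : 'Z_n := turn4 - h%:R.

(** Using [2 * h = -1], the turns add up to [speed = h] for odd [h] and [speed = - h] for even [h],
    with inverses [-2] and [2]. *)
Lemma speed_unit : exists w, speed * w = 1.
Proof.
have Eh := h_half; have E0 := Zn2h.
have z2h : (zigzag (2 * h) h)%:R = (if odd h then 2%:R * h%:R - (h./2)%:R else (h./2)%:R) :> 'Z_n.
  rewrite /zigzag; case: ifP => // _; rewrite natrB ?natrM //; lia.
rewrite /speed /turn4 /turn3 /turn2 /turn1 z2h uphalf_half natrD.
exists (if odd h then - 2%:R else 2%:R); case: (odd h) Eh => Eh.
  apply/eqP; rewrite -subr_eq0; apply/eqP.
  by rewrite -[RHS](mulr0 3%:R) -E0 /=; ring.
apply/eqP; rewrite -subr_eq0; apply/eqP.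
by rewrite -[RHS](mulr0 (-1)) -E0 /=; ring.
Qed.

End ThreeLevels.

(** * Every pair of points on the three levels is covered twice *)

Section ThreeLevelDesigns.
Local Open Scope ring_scope.
Variables N h n : nat.
Hypothesis hE : h = N.+1.
Hypothesis nE : n = (2 * h).+1.

Let n_gt1 : (1 < n)%N. Proof. by lia. Qed.
Let g := dpath N h n.
Let point := ('Z_n * 'Z_3)%type.
Let label := ((('Z_3 * nat * 'Z_n) + 'Z_n) + 'Z_n)%type.
Let pE := (xpair_eqE, eqxx, andbT, andbF, andTb, orbT, orbF).

Definition valid3 (l : label) : bool := if l is inl l' then level_label h l' else true.

Definition block3 (l : label) : {set point} :=
  match l with inl l' => level_block N h l' | inr y => column h y end.

Definition covered3 (p q : point) : Prop := exists l1 l2,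
  [/\ valid3 l1, valid3 l2, l1 != l2,
      (p \in block3 l1) && (q \in block3 l1) & (p \in block3 l2) && (q \in block3 l2)].

Lemma covered3_sym p q : covered3 p q -> covered3 q p.
Proof. by case=> l1 [l2 [? ? ? ? ?]]; exists l1, l2; split=> //; rewrite andbC. Qed.

Lemma mem_low i j (x : 'Z_n) a b : (j < h)%N ->
  (a = g i j /\ b = g i j.+1) \/ (a = g i j.+1 /\ b = g i j) ->
  [/\ (x + a, i + 1) \in block3 (inl (inl (i, j, x + a))),
      (x, i) \in block3 (inl (inl (i, j, x + a)))
    & (x + (a - b), i) \in block3 (inl (inl (i, j, x + a)))].
Proof.
move=> jh ab; rewrite /block3 /level_block jh -/g !inE !pE /=.
by case: ab => [[-> ->]|[-> ->]]; split; rewrite // ?addrK ?addrA !pE.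
Qed.

Lemma mem_high i j (x : 'Z_n) a b : (h <= j)%N ->
  (a = g i j /\ b = g i j.+1) \/ (a = g i j.+1 /\ b = g i j) ->
  [/\ (x, i) \in block3 (inl (inl (i, j, x))),
      (x + a, i + 1) \in block3 (inl (inl (i, j, x)))
    & (x + b, i + 1) \in block3 (inl (inl (i, j, x)))].
Proof.
rewrite leqNgt => /negPf jh ab; rewrite /block3 /level_block jh -/g !inE !pE /=.
by case: ab => [[-> ->]|[-> ->]]; split; rewrite // !pE.
Qed.

(** One block comes from the first half of path [i], the other from the second half of path [i - 1];
    each half contains every length once. *)
Lemma covered_level i (x x' : 'Z_n) : x != x' -> covered3 (x, i) (x', i).
Proof.
move: x x'; apply: (Zn_pairP n_gt1) => [x x'|x d dh]; first exact: covered3_sym.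
have {}dh : (0 < d <= h)%N by lia.
have [c [j jh Hc]] : exists c, exists2 j, (j < h)%N & ((x, i) \in block3 (inl (inl (i, j, c)))) &&
    ((x + d%:R, i) \in block3 (inl (inl (i, j, c)))).
  have [j jh Sj] := step_low hE nE i dh; rewrite /is_step -!/g in Sj.
  case: Sj => E.
    have [_ H1 H2] := mem_low x jh (or_intror (conj erefl erefl)) (i := i).
    exists (x + g i j.+1), j; rewrite // H1 /=.
    by have -> : d%:R = g i j.+1 - g i j by rewrite E addrC addKr.
  have [_ H1 H2] := mem_low x jh (or_introl (conj erefl erefl)) (i := i).
  exists (x + g i j), j; rewrite // H1 /=.
  by have -> : d%:R = g i j - g i j.+1 by rewrite E addrC addKr.
have [c' [j' jh' Hc']] : exists c, exists2 j, (h <= j < 2 * h)%N &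
    ((x, i) \in block3 (inl (inl (i - 1, j, c)))) &&
    ((x + d%:R, i) \in block3 (inl (inl (i - 1, j, c)))).
  have [k kh Sk] := step_high hE nE (i - 1) dh; rewrite /is_step -!/g in Sk.
  have hk : (h <= k)%N by lia.
  case: Sk => E.
    have [_] := mem_high (x - g (i - 1) k) hk (or_introl (conj erefl erefl)) (i := i - 1).
    rewrite !subrK E addrA subrK => H1 H2.
    by exists (x - g (i - 1) k), k; rewrite // H1.
  have [_] := mem_high (x - g (i - 1) k.+1) hk (or_intror (conj erefl erefl)) (i := i - 1).
  rewrite !subrK E addrA subrK => H1 H2.
  by exists (x - g (i - 1) k.+1), k; rewrite // H1.
exists (inl (inl (i, j, c))), (inl (inl (i - 1, j', c'))); split=> //=; try lia.
by apply/eqP => -[_ Ej _]; lia.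
Qed.

Lemma covered_step i j (x : 'Z_n) : (j < 2 * h)%N -> exists c,
  ((x, i) \in block3 (inl (inl (i, j, c)))) &&
  ((x + g i j, i + 1) \in block3 (inl (inl (i, j, c)))).
Proof.
move=> jh; have [jlt|jge] := ltnP j h.
  have [H1 H2 _] := mem_low x jlt (or_introl (conj erefl erefl)) (i := i).
  by exists (x + g i j); rewrite H1 H2.
have [H1 H2 _] := mem_high x jge (or_introl (conj erefl erefl)) (i := i).
by exists x; rewrite H1 H2.
Qed.

Lemma covered_prev i j (x : 'Z_n) : (j < 2 * h)%N -> exists c,
  ((x, i) \in block3 (inl (inl (i, j, c)))) &&
  ((x + g i j.+1, i + 1) \in block3 (inl (inl (i, j, c)))).
Proof.
move=> jh; have [jlt|jge] := ltnP j h.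
  have [H1 H2 _] := mem_low x jlt (or_intror (conj erefl erefl)) (i := i).
  by exists (x + g i j.+1); rewrite H1 H2.
have [H1 H2 _] := mem_high x jge (or_intror (conj erefl erefl)) (i := i).
by exists x; rewrite H1 H2.
Qed.

Lemma covered_end i j (x : 'Z_n) : j = 0%N \/ j = (2 * h)%N -> exists l : label,
  [/\ valid3 l, forall t, l != inl (inl t)
    & ((x, i) \in block3 l) && ((x + g i j, i + 1) \in block3 l)].
Proof.
have [ge00 ge0h [ge10 ge1h] [ge20 ge2h]] := dpath_ends hE nE.
have Z2h : 2%:R * h%:R + 1 = 0 :> 'Z_n.
  by rewrite -natrM natr1 -(Zn_natn n_gt1); congr (_%:R); rewrite nE.
have e3 : 1 + 1 + 1 = 0 :> 'Z_3 by exact: val_inj.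
case: (Z3_cases i) => [->|[->|->]] [->|->]; rewrite /g ?ge00 ?ge0h ?ge10 ?ge1h ?ge20 ?ge2h.
- by exists (inr x); split=> //; rewrite /= !inE add0r !pE.
- by exists (inl (inr x)); split=> //; rewrite /= !inE add0r !pE.
- by exists (inl (inr (x + 1))); split=> //; rewrite /= !inE addrK addr0 !pE.
- exists (inr (x - h%:R)); split=> //; rewrite /= !inE subrK !pE /=.
  have -> : x + (h%:R + 1) = x - h%:R by apply/eqP; rewrite -subr_eq0; apply/eqP; rewrite -[RHS]Z2h; ring.
  by rewrite !pE.
- by exists (inr x); split=> //; rewrite /= !inE addr0 e3 !pE.
by exists (inl (inr (x + 1))); split=> //; rewrite /= !inE addrK e3 !pE.
Qed.

(** The difference is some [g i j], since the path visits all of ['Z_n]. It belongs to steps [j - 1]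
    and [j]; at an end of the path a transversal block replaces the missing step. *)
Lemma covered_up i (x x' : 'Z_n) : covered3 (x, i) (x', i + 1).
Proof.
have [j jh jE] := dpath_surj hE nE i (x' - x); rewrite -/g in jE.
have -> : x' = x + g i j by rewrite jE addrC subrK.
have h0 : (0 < 2 * h)%N by lia.
have [j0|j_gt0] := posnP j.
  have [l [vl nl Hl]] := @covered_end i j x (or_introl j0).
  have [c Hc] := @covered_step i j x (eq_ind_r (fun k => (k < 2 * h)%N) h0 j0).
  by exists l, (inl (inl (i, j, c))); split=> //=; rewrite j0.
have jp : j.-1.+1 = j by rewrite prednK.
have jp_lt : (j.-1 < 2 * h)%N by rewrite jp.
have [c' Hc'] := @covered_prev i j.-1 x jp_lt; rewrite jp in Hc'.
move: jh; rewrite leq_eqVlt => /predU1P[j2h|jlt].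
  have [l [vl nl Hl]] := @covered_end i j x (or_intror j2h).
  by exists l, (inl (inl (i, j.-1, c'))); split.
have [c Hc] := @covered_step i j x jlt.
exists (inl (inl (i, j.-1, c'))), (inl (inl (i, j, c))); split=> //.
by apply/eqP => -[Ej _]; lia.
Qed.

Lemma covered3_all p q : p != q -> covered3 p q.
Proof.
case: p q => x i [x' i']; have [->|nii] := eqVneq i i'.
  by rewrite xpair_eqE eqxx andbT => /covered_level.
by move=> _; case: (Z3_levels nii) => ->; [|apply: covered3_sym]; apply: covered_up.
Qed.

End ThreeLevelDesigns.

(** * Orders 3 and 4 mod 6: joining the turns through columns or cones over them *)

Section OrderThreeOrFourModSix.
Local Open Scope ring_scope.
Variables N h n : nat.
Hypothesis hE : h = N.+1.
Hypothesis nE : n = (2 * h).+1.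

Let n_gt1 : (1 < n)%N. Proof. by lia. Qed.
Let g := dpath N h n.
Let point := ('Z_n * 'Z_3)%type.
Let pE := (xpair_eqE, eqxx, andbT, andbF, andTb, orbT, orbF).
Let lblk := @level_block N h n.
Let first_label (y : 'Z_n) : ('Z_3 * nat * 'Z_n) + 'Z_n := inl (0, 0%N, y + h%:R).
Let last_label (c : 'Z_n) : ('Z_3 * nat * 'Z_n) + 'Z_n := inl (1, (h + N)%N, c).

Lemma first_label_column (y : 'Z_n) :
  [/\ #|lblk (first_label y)| = 3%N,
      [set (y, 0); (y + h%:R, 1)] \subset lblk (first_label y)
    & forall x, (x, 1 + 1) \notin lblk (first_label y)].
Proof.
have [ge00 _ _ _] := dpath_ends hE nE; have h0 : (0 < h)%N by lia.
rewrite /first_label /lblk; split.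
- by apply: (card_level_block hE nE); rewrite /level_label; lia.
- by rewrite /level_block h0 ge00 addrK add0r subUset !sub1set !inE !pE.
by move=> x; rewrite /level_block h0 add0r !inE !pE.
Qed.

Lemma last_label_column (c : 'Z_n) :
  [/\ #|lblk (last_label c)| = 3%N,
      [set (c, 1); (c - h%:R, 1 + 1)] \subset lblk (last_label c)
    & forall x, (x, 0) \notin lblk (last_label c)].
Proof.
have [_ _ [_ ge1h] _] := dpath_ends hE nE.
have hN : (h + N < h)%N = false by lia.
have EN : (h + N).+1 = (2 * h)%N by lia.
have -> : c - h%:R = c + (h%:R + 1).
  apply/eqP; rewrite eq_sym -subr_eq0; apply/eqP.
  have <- : n%:R = 0 :> 'Z_n by exact: Zn_natn.
  have -> : n%:R = 2%:R * h%:R + 1 :> 'Z_n.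
    by rewrite -natrM natr1; congr (_%:R).
  by ring.
rewrite /last_label /lblk; split.
- by apply: (card_level_block hE nE); rewrite /level_label; lia.
- by rewrite /level_block hN EN ge1h subUset !sub1set !inE !pE.
by move=> x; rewrite /level_block hN !inE !pE.
Qed.

Lemma traceable_TTS_3mod6 : traceable_TTS (3 * n).
Proof.
have [w uw] := speed_unit hE nE.
pose W (y : 'Z_n) := [:: inr y] ++ [seq (inl l : (('Z_3 * nat * 'Z_n) + 'Z_n) + 'Z_n) | l <- level_walk N h y].
pose s := walk (speed h n) W.
have cP : #|{: point}| = (3 * n)%N by rewrite card_prod card_Zn // card_ord mulnC.
have s_mem l : valid3 h l -> l \in s.
  case: l => [l /(mem_level_walk hE nE)[y ly]|y _].
    apply: (mem_walk n_gt1 uw (y := y)); rewrite mem_cat; apply/orP; right.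
    exact: map_f.
  by apply: (mem_walk n_gt1 uw (y := y)); rewrite mem_cat mem_head.
rewrite -cP; apply: (@traceable_of_labels _ _ (@block3 N h n) (inr 0) (inl (last_label (- speed h n + turn4 h n))) s).
- move=> l /mem_walkP[y]; rewrite mem_cat inE => /orP[/eqP->|/mapP[l' ll' ->]].
    exact: card_column.
  apply: (card_level_block hE nE); exact: level_walk_label ll'.
- rewrite (size_walk _ (m := (6 * h + 2)%N)) ?cP => [|y]; first by lia.
  by rewrite size_cat size_map (size_level_walk hE) /=; lia.
- move=> p q /(covered3_all hE nE)[l1 [l2 [v1 v2 n12 H1 H2]]].
  by exists l1, l2; split=> //; apply: s_mem.
apply: (chain_walk n_gt1 (x := fun y => inr y) (z := fun y => inl (last_label (y + turn4 h n)))) => y.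
  apply: chain_cat (chain1 _ _) _ (chain_map _ (level_walk_chain hE nE y)) => //.
  have [f3 f_sub f_out] := first_label_column y.
  apply: (@card_setI3 _ _ _ (y, 0) (y + h%:R, 1) (y, 1 + 1)).
  - exact: card_column.
  - exact: f3.
  - by rewrite !pE.
  - by rewrite subUset !sub1set !inE !pE.
  - exact: f_sub.
  - by rewrite !inE !pE.
  exact: f_out.
have -> : y + speed h n = y + turn4 h n - h%:R by rewrite /speed addrA.
set c := y + turn4 h n; have [f3 f_sub f_out] := last_label_column c.
rewrite adjacent_sym.
apply: (@card_setI3 _ _ _ (c, 1) (c - h%:R, 1 + 1) (c - h%:R, 0)).
- exact: card_column.
- exact: f3.
- by rewrite !pE.
- by rewrite subUset !sub1set !inE subrK !pE.
- exact: f_sub.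
- by rewrite !inE !pE.
exact: f_out.
Qed.

Definition column_point (y : 'Z_n) (i : 'Z_3) : point :=
  (if i == 1 then y + h%:R else y, i).

(** Each column gives way to the cones over its three edges: every edge keeps one block, and the new
    point meets each column point twice. *)
Definition block4 (l : (('Z_3 * nat * 'Z_n) + 'Z_n) + ('Z_3 * 'Z_n)) : {set option point} :=
  match l with
  | inl l' => [set Some p | p in lblk l']
  | inr (i, y) => [set None; Some (column_point y i); Some (column_point y (i + 1))]
  end.

Lemma mem_column p y : (p \in column h y) = (p == column_point y p.2).
Proof.
case: p => x i; rewrite /column_point !inE !pE /=.
by case: (Z3_cases i) => [->|[->|->]]; rewrite !pE.
Qed.

Lemma card_block4_cone i y : #|block4 (inr (i, y))| = 3%N.
Proof.
have [n1 n2 _ _] := Z3_neq i.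
by apply: card_set3; rewrite // (inj_eq Some_inj) !pE n2 andbF.
Qed.

Lemma adjacent_cones i y : adjacent block4 (inr (i, y)) (inr (i + 1, y)).
Proof.
have [n1 n2 n3 n4] := Z3_neq i.
apply: (@card_setI3 _ _ _ None (Some (column_point y (i + 1))) (Some (column_point y i))).
- exact: card_block4_cone.
- exact: card_block4_cone.
- by [].
- by rewrite subUset !sub1set !inE !pE.
- by rewrite subUset !sub1set !inE !pE.
- by rewrite !inE !pE.
by rewrite !inE !(inj_eq Some_inj) !pE n2 n4 !andbF.
Qed.

Lemma adjacent_cone_level i y l : level_label h l ->
  [set column_point y i; column_point y (i + 1)] \subset lblk l ->
  adjacent block4 (inr (i, y)) (inl l).
Proof.
move=> lab; rewrite subUset !sub1set => /andP[in1 in2].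
have [n1 n2 n3 n4] := Z3_neq i.
apply: (@card_setI3 _ _ _ (Some (column_point y i)) (Some (column_point y (i + 1))) None).
- exact: card_block4_cone.
- by rewrite card_imset; [apply: (card_level_block hE nE) | apply: Some_inj].
- by rewrite (inj_eq Some_inj) !pE n2 andbF.
- by rewrite subUset !sub1set !inE !pE.
- by rewrite subUset !sub1set !mem_imset ?in1 //; exact: Some_inj.
- by rewrite !inE.
by apply/imsetP; case.
Qed.

Lemma traceable_TTS_4mod6 : traceable_TTS (3 * n).+1.
Proof.
have [w uw] := speed_unit hE nE.
pose label := ((('Z_3 * nat * 'Z_n) + 'Z_n) + ('Z_3 * 'Z_n))%type.
pose W (y : 'Z_n) : seq label := [:: inr (1, y)] ++ [:: inr (1 + 1, y)] ++ [:: inr (1 + 1 + 1, y)]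
  ++ [seq inl l | l <- level_walk N h y].
pose s := walk (speed h n) W.
have e3 : 1 + 1 + 1 = 0 :> 'Z_3 by exact: val_inj.
have cV : #|{: option point}| = (3 * n).+1.
  by rewrite card_option card_prod card_Zn // card_ord mulnC.
have inl_mem l : level_label h l -> inl l \in s.
  move=> /(mem_level_walk hE nE)[y ly].
  by apply: (mem_walk n_gt1 uw (y := y)); rewrite !mem_cat (map_f _ ly) !orbT.
have inr_mem i y : inr (i, y) \in s.
  apply: (mem_walk n_gt1 uw (y := y)); rewrite !mem_cat !mem_seq1 e3.
  by case: (Z3_cases i) => [->|[->|->]]; rewrite eqxx ?orbT.
rewrite -[X in traceable_TTS X]cV.
apply: (@traceable_of_labels _ _ block4 (inr (1, 0)) (inl (last_label (- speed h n + turn4 h n))) s).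
- move=> l /mem_walkP[y]; rewrite !mem_cat !mem_seq1 => /orP[/eqP->|/orP[/eqP->|/orP[/eqP->|/mapP[l' ll' ->]]]];
    try exact: card_block4_cone.
  rewrite card_imset; last exact: Some_inj.
  by apply: (card_level_block hE nE); apply: (level_walk_label hE nE ll').
- rewrite (size_walk _ (m := (6 * h + 4)%N)) ?cV => [|y]; first by lia.
  by rewrite !size_cat size_map (size_level_walk hE nE) /=; lia.
- have cov_None p : exists l1 l2 : label, [/\ l1 \in s, l2 \in s, l1 != l2,
      (None \in block4 l1) && (Some p \in block4 l1) & (None \in block4 l2) && (Some p \in block4 l2)].
    case: p => x i; pose y := if i == 1 then x - h%:R else x.
    have xE : (x, i) = column_point y i.
      by rewrite /column_point /y; case: (i == 1); rewrite ?subrK.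
    exists (inr (i, y)), (inr (i - 1, y)); split=> //.
    - have [_ n2 _ _] := Z3_neq (i - 1); rewrite subrK in n2.
      by change ((i, y) != (i - 1, y)); rewrite xpair_eqE eqxx andbT eq_sym n2.
    - by rewrite !inE xE !eqxx !orbT.
    by rewrite !inE subrK xE !eqxx !orbT.
  (* A column through [p] and [q] is traded for the cone over that edge. The old label is recovered
     from the new one, so distinct labels stay distinct. *)
  have lift p q l : p != q -> valid3 h l -> (p \in block3 N h l) && (q \in block3 N h l) ->
    exists l' : label, [/\ l' \in s, (Some p \in block4 l') && (Some q \in block4 l') &
      l = match l' with inl k => inl k | inr iy => inr iy.2 end].
    case: l => [l|y] npq vl /andP[pl ql].
      exists (inl l); split=> //; first exact: inl_mem.
      by rewrite !mem_imset ?pl //; exact: Some_inj.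
    move: pl ql; rewrite /block3 !mem_column => /eqP pl /eqP ql.
    have npq2 : p.2 != q.2.
      by apply: contra npq => /eqP E2; rewrite pl ql E2.
    case: (Z3_levels npq2) => E; [exists (inr (p.2, y)) | exists (inr (q.2, y))]; split=> //.
      by rewrite !inE -E -pl -ql !eqxx !orbT.
    by rewrite !inE -E -pl -ql !eqxx !orbT.
  case=> [p|] [q|] // npq; last first.
    by have [l1 [l2 [? ? ? ? ?]]] := cov_None p; exists l1, l2; split=> //; rewrite andbC.
  have {}npq : p != q by apply: contra npq => /eqP->.
  have [l1 [l2 [v1 v2 n12 H1 H2]]] := covered3_all hE nE npq.
  have [k1 [k1s K1 E1]] := lift _ _ _ npq v1 H1.
  have [k2 [k2s K2 E2]] := lift _ _ _ npq v2 H2.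
  by exists k1, k2; split=> //; apply: contra n12 => /eqP E; rewrite E1 E2 E.
apply: (chain_walk n_gt1 (x := fun y => inr (1, y)) (z := fun y => inl (last_label (y + turn4 h n)))) => y.
  (* The cones come in the order 1, 2, 0: the cone at 1 borders the end of the previous turn, and
     the cone at 0 borders the start of the level walk. *)
  refine (chain_cat (chain1 _ _) _ (chain_cat (chain1 _ _) _ (chain_cat (chain1 _ _) _
    (chain_map _ (level_walk_chain hE nE y))))).
  - exact: adjacent_cones.
  - exact: adjacent_cones.
  - rewrite e3; apply: adjacent_cone_level; first by rewrite /level_label; lia.
    by have [_] := first_label_column y; rewrite add0r.
  by move=> l l'; rewrite adjacent_Some.
have -> : y + speed h n = y + turn4 h n - h%:R by rewrite /speed addrA.
set c := y + turn4 h n; have [_ f_sub _] := last_label_column c.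
rewrite adjacent_sym; apply: adjacent_cone_level; first by rewrite /level_label /=; lia.
by rewrite /column_point eqxx subrK.
Qed.

End OrderThreeOrFourModSix.

(** * Order 4 and the assembly of the residues *)

(** All four triples of a 4-set, each labelled by the point it omits; any two of them are adjacent,
    so any order is a path. *)
Lemma traceable_TTS_4 : traceable_TTS 4.
Proof.
pose blk (i : 'I_4) := [set~ i].
have c2 (i j : 'I_4) : i != j -> #|blk i :&: blk j| = 2.
  by move=> nij; rewrite -setCU cardsCs setCK card_ord cards2 nij.
rewrite -{1}(card_ord 4).
apply: (@traceable_of_labels _ _ blk (inord 0) (inord 3) [seq inord i | i <- iota 0 4]).
- by move=> i _; rewrite cardsC1 card_ord.
- by rewrite size_map card_ord.
- move=> p q npq; have := c2 p q npq => /eqP/cards2P[l1 [l2 [n12 E]]].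
  have Bmem l : (l \in [set l1; l2]) = (l != p) && (l != q) by rewrite -E !inE.
  have all4 (i : 'I_4) : i \in [seq inord i | i <- iota 0 4].
    by apply/mapP; exists (val i); rewrite ?inord_val // mem_iota ltn_ord.
  have := Bmem l1; have := Bmem l2; rewrite !inE !eqxx orbT /=.
  move=> /esym/andP[p2 q2] /esym/andP[p1 q1].
  exists l1, l2; split=> //; first by rewrite !inE !(eq_sym _ l1) p1.
  by rewrite !inE !(eq_sym _ l2) p2.
apply: (@chain_iota _ _ (fun i => inord i) 3) => i lt3; apply/eqP/c2.
by rewrite -(inj_eq val_inj) /= !inordK //; lia.
Qed.

Lemma traceable_TTS_exists v : 3 < v -> v %% 3 < 2 -> traceable_TTS v.
Proof.
move=> v3 vmod; pose h := v %/ 6.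
have vE : v = 6 * h + v %% 6 by rewrite {1}(divn_eq v 6) mulnC.
have [E|[E|[E|E]]] : v %% 6 = 0 \/ v %% 6 = 1 \/ v %% 6 = 3 \/ v %% 6 = 4 by lia.
- have -> : v = (6 * h - 1).+1 by lia.
  (* The split of [h - 1] is even for odd [h]; for even [h] the first part exceeds the second by
     1. *)
  by apply: (@traceable_TTS_0mod6 h./2 (h - 1 - h./2) h) => //; lia.
- by apply: (@traceable_TTS_1mod6 h); lia.
- have -> : v = 3 * (2 * h).+1 by lia.
  by apply: (@traceable_TTS_3mod6 h.-1 h) => //; lia.
have [h0|h_gt0] := posnP h; first by have -> : v = 4 by [lia]; apply: traceable_TTS_4.
have -> : v = (3 * (2 * h).+1).+1 by lia.
by apply: (@traceable_TTS_4mod6 h.-1 h) => //; lia.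
Qed.

Theorem theorem1p4 (v : nat) (hv : 3 <= v) :
  (exists (V : finType) (B : seq {set V}),
      is_TTS v B /\ has_hamilton_path (@BIG2 V B))
  <-> ((v = 0 %[mod 3] \/ v = 1 %[mod 3]) /\ v <> 3).
Proof.
split=> [[V [B [tts ham]]]|[vmod v3]]; last first.
  by apply: traceable_TTS_exists; lia.
have szB := TTS_size tts; split.
  (* For [v] equal to 2 modulo 3, [v * v.-1] is also 2 modulo 3, hence not [3 * size B]. *)
  suff : v %% 3 <> 2 by lia.
  move=> v2; move: szB; rewrite (divn_eq v 3) v2; nia.
move=> v3; have [cV B3 _] := tts; rewrite v3 /= in szB cV.
have sz2 : size B = 2 by lia.
(* On three points both blocks are the whole set and meet in 3 points, so the graph has two vertices
   and no edge. *)
have full (i : 'I_(size B)) : nth set0 B i = setT.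
  by apply/eqP; rewrite eqEcard subsetT cardsT cV B3 ?mem_nth.
have noedge i j : ~~ @BIG2 V B i j by rewrite /BIG2 !full setIT cardsT cV.
case: ham => x [[|y p] [pth _ mem]]; last by move: pth; rewrite /= (negPf (noedge _ _)).
have : #|'I_(size B)| <= 1.
  by rewrite -[1](card_uniqP (isT : uniq [:: x])); apply: subset_leq_card; apply/subsetP => y _.
by rewrite card_ord sz2.
Qed.
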